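(* The value function $v$ fulfils the dynamic programming equation $$v(z) = \mathbf 1_{\{z>d\}}+ \inf_{b\in[0,1]} \mathbb E\bigl[e^{-r T_1}\,v(\Delta_{z}^b(T_1))\bigr]\qquad\text{for all } z\geq 0,$$ where $\Delta_z^b$ denotes the drawdown process with initial drawdown $z$ under the constant strategy $B_t=b$.
   Context: Setting. On a complete probability space $(\Omega,\mathcal F,\mathbb P)$ let $W$ be a standard Brownian motion and $N=\{N_t\}_{t\ge0}$ an ordinary renewal process independent of $W$, with arrival times $0=T_0<T_1<T_2<\cdots$, whose i.i.d. strictly positive interarrival times $T_{k+1}-T_k$ have an arbitrary common distribution. $\{\mathcal F_t\}_{t\ge 0}$ is the smallest right-continuous filtration to which $W$ and $N$ are adapted. Fix real constants $\eta<\theta$, $\sigma>0$, a critical level $d>0$ and a discount rate $r>0$. For $b\in[0,1]$ put $\mu(b)=\eta-(1-b)\theta$ and $\sigma(b)=\sigma b$. Strategies. $\mathcal B$ is the set of all processes $B_t=\sum_{k=0}^\infty b_k\mathbf 1_{[T_k,T_{k+1})}(t)=b_{N_t}$, where each $b_k$ is an $\mathcal F_{T_k}$-measurable random variable with values in $[0,1]$. Drawdown. For $B\in\mathcal B$ let $X_0^B(t)=\int_0^t\mu(B_s)\,ds+\int_0^t\sigma(B_s)\,dW_s$. For $z\ge0$ the drawdown process with initial drawdown $z$ is $\Delta_z^B(t)=\max\{z,\sup_{0\le s\le t}X_0^B(s)\}-X_0^B(t)$. For constant $b\in[0,1]$, $\Delta_z^b$ denotes $\Delta_z^B$ with $B_t=b$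 for all $t$. Value function. $v^B(z)=\mathbb E\bigl[\sum_{k=0}^\infty e^{-rT_k}\mathbf 1_{\{\Delta_z^B(T_k)>d\}}\bigr]$ and $v(z)=\inf_{B\in\mathcal B}v^B(z)$ for $z\ge0$. *)

(* Defs.v *)
From HB Require Import structures.
From mathcomp Require Import all_boot all_order all_algebra.
From mathcomp Require Import all_classical all_reals all_analysis.

Set Implicit Arguments.
Unset Strict Implicit.
Unset Printing Implicit Defensive.

Import Order.TTheory GRing.Theory Num.Theory.
Import numFieldNormedType.Exports.

Local Open Scope classical_set_scope.
Local Open Scope ring_scope.

(* Time runs over [0, +oo[: a process is a function of t : R and w : Om of
   which only the values at t >= 0 matter. *)

Section filtrations.
Context {R : realType} {disp : measure_display} {Om : measurableType disp}.
Implicit Types F G : R -> set (set Om).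

Definition filtration F : Prop :=
  [/\ forall t, 0 <= t -> sigma_algebra setT (F t),
      forall t, 0 <= t -> F t `<=` measurable
    & forall s t, 0 <= s -> s <= t -> F s `<=` F t].

Definition right_continuous_filtration F : Prop :=
  forall t, 0 <= t -> \bigcap_(s in [set s | t < s]) F s `<=` F t.

Definition sub_measurable {disp' : measure_display} {E : measurableType disp'}
    (S : set (set Om)) (X : Om -> E) : Prop :=
  forall A : set E, measurable A -> S (X @^-1` A).

Definition adapted {disp' : measure_display} {E : measurableType disp'}
    F (X : R -> Om -> E) : Prop :=
  forall t, 0 <= t -> sub_measurable (F t) (X t).

(* The smallest right-continuous filtration to which W and N are adapted; it is
   not augmented with null sets. *)
Definition joint_filtration (W : R -> Om -> R) (N : R -> Om -> nat)
    (t : R) : set (set Om) :=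
  [set A | forall F, filtration F -> right_continuous_filtration F ->
    adapted F W -> adapted F N -> F t A].

(* For a random time with finite values, the members of the following set are
   automatically in the sigma-algebra generated by all the F t. *)
Definition stopped_sigma_algebra F (tau : Om -> R) : set (set Om) :=
  [set A | forall t, 0 <= t -> F t (A `&` [set w | tau w <= t])].

Definition process_sigma_algebra {disp' : measure_display}
    {E : measurableType disp'} (X : R -> Om -> E) (I : set R) : set (set Om) :=
  <<s \bigcup_(t in I) preimage_set_system setT (X t) measurable >>.

End filtrations.

Section processes.
Context {R : realType} {disp : measure_display} {Om : measurableType disp}.
Variable P : probability Om R.

Definition independent_systems (S1 S2 : set (set Om)) : Prop :=
  forall A B, S1 A -> S2 B -> P (A `&` B) = (P A * P B)%E.

Definition independent_processes {disp1 disp2 : measure_display}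
    {E1 : measurableType disp1} {E2 : measurableType disp2}
    (X : R -> Om -> E1) (Y : R -> Om -> E2) : Prop :=
  independent_systems (process_sigma_algebra X [set t | 0 <= t])
                      (process_sigma_algebra Y [set t | 0 <= t]).

Definition mutually_independent (X : nat -> Om -> R) : Prop :=
  forall (J : seq nat) (A : nat -> set R), uniq J ->
    (forall k, k \in J -> measurable (A k)) ->
    P (\bigcap_(k in [set` J]) (X k @^-1` A k)) =
    (\prod_(k <- J) P (X k @^-1` A k))%E.

Definition identically_distributed (X : nat -> Om -> R) : Prop :=
  forall (j k : nat) (A : set R), measurable A ->
    P (X j @^-1` A) = P (X k @^-1` A).

(* The second argument of normal_prob is the standard deviation. *)
Record standard_brownian_motion (W : R -> Om -> R) : Prop := {
  bm_measurable : forall t, 0 <= t -> measurable_fun setT (W t);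
  bm_zero : forall w, W 0 w = 0;
  bm_continuous : forall w,
    {within [set t : R | 0 <= t], continuous (fun t => W t w)};
  bm_independent_increments : forall s t, 0 <= s -> s < t ->
    independent_systems (process_sigma_algebra W `[0, s])
      (preimage_set_system setT (fun w => W t w - W s w) measurable);
  bm_normal_increments : forall s t, 0 <= s -> s < t ->
    forall A : set R, measurable A ->
      P ((fun w => W t w - W s w) @^-1` A) = normal_prob 0 (Num.sqrt (t - s)) A
}.

(* N is the counting process of the arrival times T: renewal_count says that
   N t w is the number of k >= 1 such that T k w <= t. *)
Record renewal_process (N : R -> Om -> nat) (T : nat -> Om -> R) : Prop := {
  renewal_measurable : forall t, 0 <= t -> measurable_fun setT (N t);
  renewal_start : forall w, T 0 w = 0;
  renewal_increasing : forall k w, T k w < T k.+1 w;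
  renewal_count : forall t w k, 0 <= t -> (T k w <= t) = (k <= N t w)%N;
  renewal_independent :
    mutually_independent (fun k w => T k.+1 w - T k w);
  renewal_identically_distributed :
    identically_distributed (fun k w => T k.+1 w - T k w)
}.

End processes.

Section drawdown.
Context {R : realType} {disp : measure_display} {Om : measurableType disp}.
Variables (eta theta sigma : R).
Variables (W : R -> Om -> R) (N : R -> Om -> nat) (T : nat -> Om -> R).
Implicit Type B : R -> Om -> R.

Definition drift (b : R) : R := eta - (1 - b) * theta.

Definition volatility (b : R) : R := sigma * b.

Definition strategies : set (R -> Om -> R) :=
  [set B | exists b : nat -> Om -> R,
    [/\ forall k, sub_measurable
          (stopped_sigma_algebra (joint_filtration W N) (T k)) (b k),
        forall k w, 0 <= b k w <= 1
      & forall t w, 0 <= t -> B t w = b (N t w) w]].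

(* The stochastic integral of H with respect to W over [0, t], for a process H
   that is constant on each [T_k, T_(k+1)[: it is the finite sum of the terms
   H(T_k) (W(min(T_(k+1), t)) - W(T_k)) over the k with T_k <= t. *)
Definition simple_stochastic_integral (H : R -> Om -> R) (t : R) (w : Om) : R :=
  \sum_(k < (N t w).+1)
    H (T k w) w * (W (Num.min (T k.+1 w) t) w - W (T k w) w).

Definition surplus B (t : R) (w : Om) : R :=
  \int[lebesgue_measure]_(s in `[0, t]) drift (B s w) +
  simple_stochastic_integral (fun s w' => volatility (B s w')) t w.

Definition drawdown B (z t : R) (w : Om) : R :=
  Num.max z (sup [set surplus B s w | s in `[0, t]]) - surplus B t w.

Variables (d r : R) (P : probability Om R).

Definition strategy_value B (z : R) : \bar R :=
  (\int[P]_w \sum_(0 <= k <oo)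
    (expR (- r * T k w) * (d < drawdown B z (T k w) w)%R%:R)%:E)%E.

Definition value (z : R) : \bar R :=
  ereal_inf [set strategy_value B z | B in strategies].

End drawdown.

(* Main.v *)
(* Let u_0 = 0 and let u_(n+1) be obtained from u_n by the operator on the right-hand
   side of the equation. By the strong Markov property of (W, N) at the arrival times,
   the drawdown at T_(k+1) is a functional of the drawdown and the retention level at
   T_k and of a block (T_(k+1) - T_k, W(T_k + .) - W(T_k)) that is independent of the
   past and distributed as the first one. Hence every strategy costs at least u_n.
   Conversely u_n is nondecreasing in z, so almost optimal actions can be selected
   measurably, and the resulting n-step strategy costs at most u_n plus the tail
   g^n / (1 - g), where g = E exp(- r T_1) < 1. Thus u_n <= v <= u_n + g^n / (1 - g),
   and since the operator is monotone and satisfies L(u + c) <= L u + c for c >= 0, the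
   fixed point equation follows for n tending to infinity. *)
Require Import Defs.
From HB Require Import structures.
From mathcomp Require Import all_boot all_order all_algebra.
From mathcomp Require Import all_classical all_reals all_analysis.
From mathcomp Require Import measurable_realfun ring.

Import Order.TTheory GRing.Theory Num.Theory.
Import numFieldNormedType.Exports.

Local Open Scope classical_set_scope.
Local Open Scope ring_scope.

Set Implicit Arguments.
Unset Strict Implicit.
Unset Printing Implicit Defensive.

(** * Path spaces and factorization of probabilities *)

(** Two obstacles shape the proof. The first is the past. The filtration is known only as the
    smallest right-continuous one, and with arbitrary interarrival laws the pair (W, N) need not
    restart at a fixed time. At [T k] two different enlargements of the past are therefore used: the
    past of [W] together with all of [N], which lets [W] restart while the next gap is kept, and all
    of [W] together with the first k gaps, which is independent of the next gap. Concrete generators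
    describe the past at time t only through times strictly larger than t; dyadic times slightly
    above [T k] bridge the difference. The second obstacle is measurability. A drawdown involves a
    supremum over a continuum of times, so paths are recorded at dyadic times only, in a space with
    the sigma-algebra of cylinders, and continuity recovers the supremum. The value functions,
    infima over uncountably many actions, are measurable because they are monotone in the initial
    drawdown. *)

Definition box {R : realType} {I : eqType} (J : seq I) (C : I -> set R) :
    set (I -> R) :=
  [set p | forall i, i \in J -> C i (p i)].

Definition boxes {R : realType} {I : eqType} (K : set (set R)) :
    set (set (I -> R)) :=
  [set B | exists J C, (forall i, K (C i)) /\ B = box J C].

(** The product sigma-algebra, presented by finite-dimensional cylinders. These are closed under
    intersection, so laws of paths can be compared on boxes alone. *)
Definition path_space (R : realType) (I : eqType) :=
  g_sigma_algebraType (@boxes R I measurable).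

HB.instance Definition _ (R : realType) (I : eqType) :=
  Measurable.on (path_space R I).

Section path_space_theory.
Context {R : realType} {I : eqType}.
Implicit Types (K : set (set R)) (J : seq I).

Lemma boxes_setI_closed K : setI_closed K -> setI_closed (@boxes R I K).
Proof.
move=> KI _ _ [J1 [C1 [KC1 ->]]] [J2 [C2 [KC2 ->]]].
exists (J1 ++ J2), (fun i => if i \in J1 then
  (if i \in J2 then C1 i `&` C2 i else C1 i) else C2 i); split=> [i|].
  by case: ifP => _ //; case: ifP => _ //; exact: KI.
apply/seteqP; split=> p /=.
  move=> [h1 h2] i; rewrite mem_cat => /orP[] iJ.
    by rewrite iJ; case: ifP => iJ2; [split; [exact: h1|exact: h2]|exact: h1].
  by rewrite iJ; case: ifP => iJ1; [split; [exact: h1|exact: h2]|exact: h2].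
move=> h; split=> i iJ; have := h i; rewrite mem_cat iJ ?orbT => /(_ isT).
  by case: ifP => // _ [].
by case: ifP => // _ [].
Qed.

Lemma measurable_path_eval (i : I) :
  measurable_fun setT (fun p : path_space R I => p i).
Proof.
move=> _ C mC; rewrite setTI; apply: sub_sigma_algebra.
exists [:: i], (fun=> C); split => //; apply/seteqP; split => p /=.
  by move=> Cp j; rewrite inE => /eqP ->.
by move=> /(_ i); apply; rewrite inE.
Qed.

Lemma path_space_measurable_boxes :
  @measurable _ (path_space R I) = <<s @boxes R I measurable >>.
Proof. by []. Qed.

(** Allows the coordinates to be tested on half-lines only, which is what limits of paths require in
    [factorization_limit]. *)
Lemma path_space_measurableE K : @measurable _ R = <<s K >> ->
  @measurable _ (path_space R I) = <<s @boxes R I K >>.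
Proof.
move=> KE; apply/seteqP; split.
  apply: smallest_sub; first exact: smallest_sigma_algebra.
  move=> _ [J [C [mC ->]]].
  pose E := g_sigma_algebraType (@boxes R I K).
  have me i : measurable_fun setT (fun p : E => p i).
    apply: (measurability _ KE) => _ [B KB <-]; rewrite setTI.
    apply: sub_sigma_algebra; exists [:: i], (fun=> B); split => //.
    apply/seteqP; split => p /=.
      by move=> Bp j; rewrite inE => /eqP ->.
    by move=> /(_ i); apply; rewrite inE.
  rewrite [box J C](_ : _ = \bigcap_(i in [set` J]) [set p | C i (p i)])//.
  suff : @measurable _ E (\bigcap_(i in [set` J]) [set p : E | C i (p i)]) by [].
  apply: fin_bigcap_measurable => [|i _]; first exact: finite_seq.
  rewrite -[X in measurable X]setTI; exact: me.
apply: smallest_sub; first exact: smallest_sigma_algebra.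
move=> _ [J [C [KC ->]]]; apply: sub_sigma_algebra.
by exists J, C; split => // i; rewrite KE; apply: sub_sigma_algebra.
Qed.

Lemma measurable_to_path d (T : measurableType d) (f : T -> path_space R I) :
  (forall i, measurable_fun setT (fun x => f x i)) -> measurable_fun setT f.
Proof.
move=> mf.
apply: (@measurability _ _ T (path_space R I) setT f (@boxes R I measurable) erefl).
move=> _ [_ [J [C [mC ->]]] <-]; rewrite setTI.
rewrite [f @^-1` _](_ : _ =
  \bigcap_(i in [set` J]) ((fun x => f x i) @^-1` C i))//.
apply: fin_bigcap_measurable => [|i _]; first exact: finite_seq.
rewrite -[X in measurable X]setTI; exact: mf.
Qed.

End path_space_theory.

Section probability_lemmas.
Context {R : realType} {disp : measure_display} {Om : measurableType disp}.
Variable P : probability Om R.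
Implicit Types A S : set Om.

Lemma measurable_preim {d} {E : measurableType d} {X : Om -> E} {B : set E} :
  measurable_fun setT X -> measurable B -> measurable (X @^-1` B).
Proof. by move=> mX mB; rewrite -[X in measurable X]setTI; exact: mX. Qed.

Lemma fin_num_prob A : measurable A -> P A \is a fin_num.
Proof. exact: fin_num_measure. Qed.

Lemma prob_setIC A (B : set Om) : measurable A -> measurable B ->
  P (A `&` ~` B) = (P A - P (A `&` B))%E.
Proof.
move=> mA mB; rewrite -setDE measureD//.
by rewrite (le_lt_trans (probability_le1 P mA))// ltry.
Qed.

(** The conclusion says at once that [X] is independent of the event [A] and, if [A] is not null,
    that it has the law of [Y]. Both sides are finite measures in [B], so the sets on which they
    agree form a Dynkin system. *)
Lemma factorization_dynkin {d} {E : measurableType d} (X Y : Om -> E) A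
    (G : set (set E)) :
  measurable A -> measurable_fun setT X -> measurable_fun setT Y ->
  @measurable _ E = <<s G >> -> setI_closed G ->
  (forall B, G B -> P (A `&` X @^-1` B) = P A * P (Y @^-1` B))%E ->
  forall B, measurable B -> (P (A `&` X @^-1` B) = P A * P (Y @^-1` B))%E.
Proof.
move=> mA mX mY GE GI GP B mB.
apply: (dynkin_induction (G := G)
  (P := [set B | P (A `&` X @^-1` B) = P A * P (Y @^-1` B)]%E)) => //=.
- by rewrite !preimage_setT setIT probability_setT mule1.
- move=> S mS PS.
  rewrite -!preimage_setC.
  rewrite prob_setIC//; last exact: measurable_preim.
  rewrite PS probability_setC; last exact: measurable_preim.
  rewrite muleBr ?mule1//; first exact: fin_num_prob.
- move=> F mF tF PF.
  rewrite !preimage_bigcup setI_bigcupr.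
  rewrite measure_bigcup//=; last 2 first.
  - by move=> i _; apply: measurableI => //; exact: measurable_preim.
  - apply/trivIsetP => i j _ _ ij; rewrite setIACA setIid -preimage_setI.
    by move/trivIsetP : tF => /(_ _ _ _ _ ij) -> //; rewrite preimage_set0 setI0.
  rewrite measure_bigcup//=; last 2 first.
  - by move=> i _; exact: measurable_preim.
  - apply/trivIsetP => i j _ _ ij; rewrite -preimage_setI.
    by move/trivIsetP : tF => /(_ _ _ _ _ ij) -> //; rewrite preimage_set0.
  rewrite (eq_eseriesr (fun i _ => PF i)).
  by rewrite -(fineK (fin_num_prob mA)) nneseriesZl.
- by rewrite -GE.
Qed.

(** The previous lemma with both random elements equal to the identity, viewed as a map into the
    same set with the sigma-algebra generated by [G]; the two events exchange roles. *)
Lemma independent_dynkin (B : set Om) (G : set (set Om)) :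
  measurable B -> setI_closed G -> G `<=` measurable ->
  (forall A, G A -> P (A `&` B) = P A * P B)%E ->
  forall A, <<s G >> A -> (P (A `&` B) = P A * P B)%E.
Proof.
move=> mB GI mG GP A GA.
have mid : measurable_fun setT (id : Om -> g_sigma_algebraType G).
  move=> _ C mC; rewrite setTI /=.
  have := @smallest_sub _ (sigma_algebra setT) G measurable.
  by apply=> //; exact: sigma_algebra_measurable.
have := @factorization_dynkin _ (g_sigma_algebraType G) id id B G mB mid mid
  erefl GI.
move=> h; rewrite setIC muleC; apply: (h _ A GA) => C GC /=.
by rewrite setIC muleC; exact: GP.
Qed.

(** Fatou's lemma for events: [S] lies in the increasing union of the tail intersections [U n], each
    of probability at most [c]. *)
Lemma prob_liminf_le (S : set Om) (F : nat -> set Om) (c : \bar R) :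
  measurable S -> (forall n, measurable (F n)) ->
  (forall w, S w -> \forall n \near \oo, F n w) ->
  (forall n, P (F n) <= c)%E -> (P S <= c)%E.
Proof.
move=> mS mF SF Fc.
pose U n := \bigcap_(m in [set m | (n <= m)%N]) F m.
have mU n : measurable (U n) by exact: bigcap_measurableType.
have cU : P \o U @ \oo --> P (\bigcup_n U n).
  apply: nondecreasing_cvg_mu => //; first exact: bigcupT_measurable.
  move=> m n mn; apply/subsetPset => w Uw k /= nk.
  by apply: Uw => /=; exact: leq_trans nk.
have SU : S `<=` \bigcup_n U n.
  by move=> w /SF [n _ h]; exists n => // m /= nm; exact: h.
have mUU : measurable (\bigcup_n U n) by exact: bigcupT_measurable.
apply: (@le_trans _ _ (P (\bigcup_n U n))); first by rewrite le_measure ?inE.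
rewrite -(cvg_lim (@ereal_hausdorff R) cU); apply: lime_le.
  by apply/cvg_ex; eexists; exact: cU.
apply: nearW => n /=; apply: (le_trans _ (Fc n)).
by rewrite le_measure ?inE// => w; apply => /=.
Qed.

End probability_lemmas.

(** * The drawdown as a functional of the driving path *)

Section dyadic_times.
Context {R : realType}.
Implicit Types (n j : nat) (s t : R).

Definition dyadic n j : R := j%:R / 2 ^+ n.

Definition dyadic_index n t : nat := Num.truncn (2 ^+ n * t).

Lemma dyadic_ge0 n j : 0 <= dyadic n j.
Proof. by rewrite divr_ge0// exprn_ge0. Qed.

Lemma le_dyadic_index n s t : s <= t -> (dyadic_index n s <= dyadic_index n t)%N.
Proof. by move=> st; apply: le_truncn; rewrite ler_wpM2l// exprn_ge0. Qed.

Lemma dyadic_index_le n t : 0 <= t -> dyadic n (dyadic_index n t) <= t.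
Proof.
move=> t0; rewrite /dyadic ler_pdivrMr ?exprn_gt0// mulrC.
by rewrite truncn_le mulr_ge0// exprn_ge0.
Qed.

Lemma dyadic_index_gt n t : t < dyadic n (dyadic_index n t).+1.
Proof. by rewrite /dyadic ltr_pdivlMr ?exprn_gt0// mulrC truncnS_gt. Qed.

Lemma dyadicD n j k : dyadic n (j + k) = dyadic n j + dyadic n k.
Proof. by rewrite /dyadic natrD mulrDl. Qed.

Lemma cvg_dyadic_offset n0 : dyadic n n0 @[n --> \oo] --> (0 : R).
Proof.
have h : `|2^-1 : R| < 1 by rewrite ger0_norm// invf_lt1// ltr1n.
have := cvg_geometric (n0%:R : R) h; apply: cvg_trans; apply: near_eq_cvg.
by near=> n; rewrite /geometric/= /dyadic exprVn.
Unshelve. all: by end_near. Qed.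

(** Offset 0 approximates a time from below and is used for adaptedness; offset 2 approximates an
    arrival time from above and is used for its past. *)
Lemma cvg_dyadic_index k t : 0 <= t ->
  dyadic n (dyadic_index n t + k) @[n --> \oo] --> t.
Proof.
move=> t0.
apply: (@squeeze_cvgr _ _ _ _ (fun n => t - dyadic n 1) (fun n => t + dyadic n k)).
- near=> n; rewrite dyadicD; apply/andP; split; last first.
    by rewrite lerD2r dyadic_index_le.
  have := dyadic_index_gt n t; rewrite -addn1 dyadicD => /ltW.
  by rewrite -lerBlDr => /le_trans; apply; rewrite lerDl dyadic_ge0.
- rewrite -[X in _ --> X]subr0; apply: cvgB; first exact: cvg_cst.
  exact: cvg_dyadic_offset.
- rewrite -[X in _ --> X]addr0; apply: cvgD; first exact: cvg_cst.
  exact: cvg_dyadic_offset.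
Unshelve. all: by end_near. Qed.

Lemma dyadic_refine n m j : (n <= m)%N -> dyadic n j = dyadic m (j * 2 ^ (m - n)).
Proof.
move=> nm; rewrite /dyadic natrM natrX -[in 2 ^+ m](subnKC nm) exprD invfM.
by rewrite [(2 ^+ n)^-1 * _]mulrC !mulrA mulfK// expf_neq0// pnatr_eq0.
Qed.

Lemma measurable_dyadic_index n j : measurable [set t | dyadic_index n t = j].
Proof.
have m : measurable_fun setT (fun t => (dyadic_index n t)%:R : R).
  by apply: nondecreasing_measurable => // s t st; rewrite ler_nat le_dyadic_index.
rewrite [X in measurable X](_ : _ =
  (fun t => (dyadic_index n t)%:R : R) @^-1` [set j%:R]).
  by rewrite -[X in measurable X]setTI; exact: m.
by apply/seteqP; split => t /=; [move=> ->|move=> /eqP; rewrite eqr_nat => /eqP].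
Qed.

End dyadic_times.

Lemma measurable_countable_glue d d' (T : measurableType d)
    (E : measurableType d') (k : T -> nat) (g : nat -> T -> E) :
  (forall j, measurable (k @^-1` [set j])) ->
  (forall j, measurable_fun setT (g j)) ->
  measurable_fun setT (fun x => g (k x) x).
Proof.
move=> mk mg _ B mB; rewrite setTI.
rewrite [X in measurable X](_ : _ =
  \bigcup_j (k @^-1` [set j] `&` g j @^-1` B)).
  apply: bigcupT_measurable => j; apply: measurableI => //.
  by rewrite -[X in measurable X]setTI; exact: mg.
by apply/seteqP; split => x /=; [move=> ?; exists (k x)|move=> [j _ [<-]]].
Qed.

Lemma measurable_fun_bigmaxr d (T : measurableType d) (R : realType) (I : Type)
    (s : seq I) (f : T -> R) (F : I -> T -> R) :
  measurable_fun setT f -> (forall i, measurable_fun setT (F i)) ->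
  measurable_fun setT (fun x => \big[Num.max/f x]_(i <- s) F i x).
Proof.
move=> mf mF; elim: s => [|i s IH].
  by under eq_fun do rewrite big_nil.
by under eq_fun do rewrite big_cons; exact: measurable_maxr.
Qed.

(** A continuous path attains its maximum over [0, t] at some [c]. All grid points that occur are at
    most t, which bounds the discrete maxima from above; the grid points just below [c] bound them
    from below in the limit. *)
Lemma dyadic_running_max_cvg (R : realType) (Y : R -> R) (z t : R) :
  continuous Y -> 0 <= t ->
  \big[Num.max/z]_(j < (dyadic_index n t).+1) Y (dyadic n j) -
    Y (dyadic n (dyadic_index n t)) @[n --> \oo] -->
  Num.max z (sup [set Y s | s in `[0, t]]) - Y t.
Proof.
move=> cY t0.
have cYn s : 0 <= s -> Y (dyadic n (dyadic_index n s)) @[n --> \oo] --> Y s.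
  move=> s0; have := @cvg_dyadic_index R 0 s s0.
  under eq_fun do rewrite addn0.
  by move=> h; apply: (cvg_comp _ _ h); exact: cY.
apply: cvgB; last exact: cYn.
have [|c /[!in_itv]/= /andP[c0 ct] cmax] := EVT_max t0 (f := Y).
  by apply: continuous_subspaceT => x; exact: cY.
have -> : sup [set Y s | s in `[0, t]] = Y c.
  apply/le_anti/andP; split.
    apply: sup_le_ub; first by exists (Y c), c => //=; rewrite in_itv/= c0 ct.
    by move=> _ [s sI <-]; exact: cmax.
  apply: ub_le_sup; last by exists c => //=; rewrite in_itv/= c0 ct.
  by exists (Y c) => _ [s sI <-]; exact: cmax.
have Mle n : \big[Num.max/z]_(j < (dyadic_index n t).+1) Y (dyadic n j) <=
    Num.max z (Y c).
  apply: bigmax_le => [|j _]; first by rewrite le_max lexx.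
  rewrite le_max; apply/orP; right; apply: cmax; rewrite in_itv/= dyadic_ge0/=.
  apply: le_trans (dyadic_index_le n t0).
  by rewrite /dyadic ler_wpM2r ?invr_ge0 ?exprn_ge0// ler_nat -ltnS.
(* If the initial level [z] dominates the path, the discrete maxima are constantly [z]; otherwise
   they are squeezed towards [Y c]. *)
have [Ycz|zYc] := leP (Y c) z.
  apply: (@squeeze_cvgr _ _ _ _ (cst z) (cst z)); try exact: cvg_cst.
  near=> n => /=; rewrite bigmax_ge_id/=.
  by apply: (le_trans (Mle n)); rewrite ge_max lexx.
apply: (@squeeze_cvgr _ _ _ _
  (fun n => Y (dyadic n (dyadic_index n c))) (cst (Y c))); last 2 first.
- exact: cYn.
- exact: cvg_cst.
near=> n => /=; apply/andP; split; last first.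
  by apply: (le_trans (Mle n)); rewrite ge_max lexx ltW.
have h : (dyadic_index n c < (dyadic_index n t).+1)%N.
  by rewrite ltnS le_dyadic_index.
exact: (@le_bigmax _ _ _ z (fun j : 'I_(dyadic_index n t).+1 => Y (dyadic n j))
  (Ordinal h)).
Unshelve. all: by end_near. Qed.

Section drawdown_map.
Context {R : realType}.
Variables eta theta sigma : R.

(* [p (n, j)] stands for the value of the driving path at time [j / 2 ^ n];
   the functional is only meaningful on the traces of continuous paths. *)
Definition dyadic_drawdown (z b t : R) (p : path_space R (nat * nat)%type)
    (n : nat) : R :=
  let k := dyadic_index n t in
  let Y j := drift eta theta b * dyadic n j + volatility sigma b * p (n, j) in
  \big[Num.max/z]_(j < k.+1) Y j - Y k.

(** A limit superior exists and is measurable in [p] for every array of numbers, whether or not it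
    is the trace of a path. *)
Definition drawdown_map (z b t : R) (p : path_space R (nat * nat)%type) : R :=
  fine (limn_esup (fun n => (dyadic_drawdown z b t p n)%:E)).

Lemma measurable_drawdown_map d (T : measurableType d) (z b t : T -> R)
    (p : T -> path_space R (nat * nat)%type) :
  measurable_fun setT z -> measurable_fun setT b -> measurable_fun setT t ->
  measurable_fun setT p ->
  measurable_fun setT (fun w => drawdown_map (z w) (b w) (t w) (p w)).
Proof.
move=> mz mb mt mp; apply: measurableT_comp => //.
apply: measurable_fun_limn_esup => n; apply/measurable_EFinP.
pose Y j w := drift eta theta (b w) * dyadic n j +
  volatility sigma (b w) * p w (n, j).
have mY j : measurable_fun setT (Y j).
  apply: measurable_funD; apply: measurable_funM => //.
  - apply: measurable_funB => //; apply: measurable_funM => //.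
    exact: measurable_funB.
  - exact: measurable_funM.
  - exact: (measurableT_comp (measurable_path_eval (n, j)) mp).
(* The number of grid points depends on the random length [t]; it is fixed on each of countably many
   measurable cells. *)
apply: (@measurable_countable_glue _ _ _ _ (fun w => dyadic_index n (t w))
  (fun k w => \big[Num.max/z w]_(j < k.+1) Y j w - Y k w)).
  move=> j; rewrite -[X in measurable X]setTI.
  by apply: (mt _ [set t | dyadic_index n t = j]) => //; exact: measurable_dyadic_index.
move=> k; apply: measurable_funB => //.
exact: (@measurable_fun_bigmaxr _ _ _ _ (index_enum 'I_k.+1) z
  (fun j => Y (nat_of_ord j))).
Qed.

(** Agreement is asked only at dyadic times up to [t], so that arrays coming from paths that differ
    after [t] give the same drawdown. *)
Lemma drawdown_mapE (z b t : R) (p : path_space R (nat * nat)%type)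
    (Y : R -> R) :
  continuous Y -> 0 <= t ->
  (forall n j, dyadic n j <= t -> Y (dyadic n j) =
    drift eta theta b * dyadic n j + volatility sigma b * p (n, j)) ->
  drawdown_map z b t p = Num.max z (sup [set Y s | s in `[0, t]]) - Y t.
Proof.
move=> cY t0 YE; rewrite /drawdown_map.
have h := @dyadic_running_max_cvg R Y z t cY t0.
have {}h : dyadic_drawdown z b t p n @[n --> \oo] -->
    Num.max z (sup [set Y s | s in `[0, t]]) - Y t.
  apply: cvg_trans h; apply: near_eq_cvg; near=> n.
  rewrite /dyadic_drawdown -YE ?dyadic_index_le//; congr (_ - _).
  apply: eq_bigr => j _; apply: YE; apply: le_trans (dyadic_index_le n t0).
  by rewrite /dyadic ler_wpM2r ?invr_ge0 ?exprn_ge0// ler_nat -ltnS.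
have {}h : (dyadic_drawdown z b t p n)%:E @[n --> \oo] -->
    (Num.max z (sup [set Y s | s in `[0, t]]) - Y t)%:E.
  by apply: cvg_EFin; [exact: nearW|exact: h].
rewrite is_cvg_limn_esupE; last by apply/cvg_ex; eexists; exact: h.
by rewrite (cvg_lim (@ereal_hausdorff R) h).
Unshelve. all: by end_near. Qed.

End drawdown_map.

(** Brownian paths are continuous only within the half-line; freezing them at time 0 for negative
    times makes the continuity global. *)
Lemma continuous_positive_part (R : realType) (f : R -> R) :
  {within [set t | 0 <= t], continuous f} ->
  continuous (fun t : R => f (Num.max 0 t)).
Proof.
move=> /subspace_continuousP cf s U nU.
have m0 : 0 <= Num.max 0 s by rewrite le_max lexx.
have /= := cf _ m0 U nU; rewrite /within/= => h.
have cmax : continuous (fun t : R => Num.max 0 t).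
  move=> x; rewrite (_ : (fun t : R => _) = (fun t => (0 + t + `|0 - t|) / 2)).
    rewrite -/(continuous_at x (fun t : R => (0 + t + `|0 - t|) / 2)).
    apply: cvgM; last exact: cvg_cst.
    apply: cvgD; first by apply: cvgD; [exact: cvg_cst|exact: cvg_id].
    by apply: cvg_norm; apply: cvgB; [exact: cvg_cst|exact: cvg_id].
  by apply/funext => t; exact: maxr_absE.
have h2 : \forall t \near s, 0 <= Num.max 0 t -> U (f (Num.max 0 t)).
  exact: (cmax s _ h).
change (\forall t \near s, U (f (Num.max 0 t))).
apply: filterS h2 => t; apply.
by rewrite le_max lexx.
Qed.

(** All steps are carried out on [[0, t[], because at [t = tau k.+1] the integrand already has its
    next value. The single endpoint, a null set, is added last. *)
Lemma Rintegral_step (R : realType) (f : R -> R) (tau c : nat -> R) (M : R) :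
  tau 0%N = 0 -> (forall k, tau k < tau k.+1) ->
  (forall k s, tau k <= s < tau k.+1 -> f s = c k) ->
  (forall k, `|c k| <= M) ->
  forall k t, tau k <= t <= tau k.+1 ->
  \int[lebesgue_measure]_(s in `[0, t]) f s =
    \sum_(i < k) c i * (tau i.+1 - tau i) + c k * (t - tau k).
Proof.
move=> tau0 tau_incr fE cM.
have tau_ge0 k : 0 <= tau k.
  by elim: k => [|k IH]; [rewrite tau0|exact: (le_trans IH (ltW (tau_incr k)))].
have split_itv k t : tau k <= t -> `[0, t[%classic = `[0, tau k[ `|` `[tau k, t[.
  by move=> kt; apply: itv_bndbnd_setU; rewrite bnd_simp.
have feq k t : t <= tau k.+1 -> {in `[tau k, t[%classic, f =1 cst (c k)}.
  move=> tk s; rewrite inE/= in_itv/= => /andP[ks st].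
  by apply: fE; rewrite ks (lt_le_trans st).
have mf k t : tau k <= t <= tau k.+1 -> measurable_fun `[0, t[ f.
  elim: k t => [|k IH] t /andP[kt tk].
    apply: (eq_measurable_fun (cst (c 0%N))) => //.
    by move=> s; rewrite -{1}tau0 => h; rewrite (feq _ _ tk).
  rewrite (split_itv _ _ kt); apply/measurable_funU => //; split.
    by apply: IH; rewrite lexx (ltW (tau_incr k)).
  by apply: (eq_measurable_fun (cst (c k.+1))) => // s h; rewrite (feq _ _ tk).
have fM k t : tau k <= t <= tau k.+1 -> forall s, 0 <= s < t -> `|f s| <= M.
  elim: k t => [|k IH] t /andP[kt tk] s /andP[s0 st].
    by rewrite (fE 0%N) ?tau0 ?s0 ?(lt_le_trans st).
  have [sk|ks] := ltP s (tau k.+1).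
    by apply: (IH (tau k.+1)); rewrite ?lexx ?(ltW (tau_incr k)) ?s0.
  by rewrite (fE k.+1) ?ks ?(lt_le_trans st).
have multy (a b : R) : (@lebesgue_measure R `[a, b[%classic < +oo)%E.
  rewrite lebesgue_measure_itv/=.
  by case: ifP => _; [rewrite -EFinB ltry|rewrite ltry].
have intf k t : tau k <= t <= tau k.+1 ->
    (@lebesgue_measure R).-integrable `[0, t[ (EFin \o f).
  move=> kt; apply: measurable_bounded_integrable => //.
  - exact: multy.
  - exact: mf kt.
  - exists M; split; first exact: num_real.
    move=> x Mx s /= /[!in_itv]/= st; apply: le_trans (ltW Mx).
    exact: (fM _ _ kt).
have intc k t : tau k <= t <= tau k.+1 ->
    \int[lebesgue_measure]_(s in `[tau k, t[) f s = c k * (t - tau k).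
  move=> /andP[kt tk].
  transitivity (\int[lebesgue_measure]_(s in `[tau k, t[) cst (c k) s).
    by apply: eq_Rintegral => s sI; exact: (feq _ _ tk).
  transitivity (c k * fine (@lebesgue_measure R `[tau k, t[)).
    exact: Rintegral_cst.
  rewrite lebesgue_measure_itv/= lte_fin.
  case: ltP => [_|]; first by rewrite -EFinB.
  by move=> t0; rewrite (le_anti (introT andP (conj t0 kt))) subrr.
have main k t : tau k <= t <= tau k.+1 ->
    \int[lebesgue_measure]_(s in `[0, t[) f s =
    \sum_(i < k) c i * (tau i.+1 - tau i) + c k * (t - tau k).
  elim: k t => [|k IH] t /[dup] kkt /andP[kt tk].
    have e0 : `[0, t[%classic = `[tau 0%N, t[%classic by rewrite tau0.
    by rewrite big_ord0 add0r e0 intc.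
  rewrite (split_itv _ _ kt) Rintegral_setU//; last 2 first.
  - by rewrite -(split_itv _ _ kt); exact: intf kkt.
  - apply/disj_setPS => s [/=]; rewrite !in_itv/= => /andP[_ h1] /andP[h2 _].
    by move: (lt_le_trans h1 h2); rewrite ltxx.
  by rewrite IH ?lexx ?(ltW (tau_incr k))// big_ord_recr/= intc.
move=> k t kt; rewrite -(main _ _ kt) Rintegral_itv_bndo_bndc//.
exact: intf kt.
Qed.

(** * The drawdown at consecutive arrival times *)

Section drawdown_recursion.
Context {R : realType} {disp : measure_display} {Om : measurableType disp}.
Variables (eta theta sigma : R).
Variables (W : R -> Om -> R) (N : R -> Om -> nat) (T : nat -> Om -> R).
Hypothesis W_continuous :
  forall w, {within [set t : R | 0 <= t], continuous (fun t => W t w)}.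
Hypothesis T0 : forall w, T 0%N w = 0.
Hypothesis T_increasing : forall k w, T k w < T k.+1 w.
Hypothesis T_count : forall t w k, 0 <= t -> (T k w <= t) = (k <= N t w)%N.

Lemma arrival_ge0 k w : 0 <= T k w.
Proof.
by elim: k => [|k IH]; [rewrite T0|exact: (le_trans IH (ltW (T_increasing k w)))].
Qed.

Lemma count_between k t w : T k w <= t < T k.+1 w -> N t w = k.
Proof.
move=> /andP[kt tk]; have t0 := le_trans (arrival_ge0 k w) kt.
apply/eqP; rewrite eqn_leq -(T_count _ _ t0) kt andbT -ltnS ltnNge.
by rewrite -(T_count _ _ t0) -ltNge.
Qed.

(** The Brownian path restarted at height zero at time [S], which will be an arrival time, a dyadic
    approximation of one, or a constant. *)
Definition shifted_path (S : Om -> R) (w : Om) : path_space R (nat * nat)%type :=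
  fun i => W (S w + dyadic i.1 i.2) w - W (S w) w.

Variables (B : R -> Om -> R) (b : nat -> Om -> R) (w : Om).
Hypothesis b01 : forall k, 0 <= b k w <= 1.
Hypothesis BE : forall t, 0 <= t -> B t w = b (N t w) w.

Let X t := surplus eta theta sigma W N T B t w.

Lemma surplus_between k t : T k w <= t <= T k.+1 w ->
  X t = X (T k w) + (drift eta theta (b k w) * (t - T k w) +
    volatility sigma (b k w) * (W t w - W (T k w) w)).
Proof.
have BT k' : B (T k' w) w = b k' w.
  by rewrite BE ?arrival_ge0// (@count_between k')// lexx T_increasing.
have ssiE t' k' : T k' w <= t' <= T k'.+1 w ->
    simple_stochastic_integral W N T (fun s w' => volatility sigma (B s w')) t' w
    = \sum_(i < k') volatility sigma (b i w) * (W (T i.+1 w) w - W (T i w) w) +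
      volatility sigma (b k' w) * (W t' w - W (T k' w) w).
  (* At the right endpoint the count has already jumped, and the integral has one more summand; it
     is zero because its increment of [W] starts and ends at the same time. *)
  move=> /andP[kt]; rewrite le_eqVlt => /predU1P[->|tk].
    rewrite /simple_stochastic_integral (@count_between k'.+1) ?lexx ?T_increasing//.
    rewrite big_ord_recr/= min_r ?ltW ?T_increasing// subrr mulr0 addr0.
    rewrite big_ord_recr/= BT minxx; congr (_ + _); apply: eq_bigr => i _.
    rewrite BT min_l//.
    rewrite (T_count _ _ (arrival_ge0 k'.+1 w)).
    by rewrite (@count_between k'.+1) ?lexx ?T_increasing// ltnS ltnW.
  rewrite /simple_stochastic_integral (@count_between k') ?kt//.
  rewrite big_ord_recr/= BT min_r ?(ltW tk)//; congr (_ + _).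
  apply: eq_bigr => i _; rewrite BT min_l//.
  rewrite (T_count _ _ (le_trans (arrival_ge0 k' w) kt)).
  by rewrite (@count_between k') ?kt.
(* The bound |eta| + |theta| on the drift is valid because 1 - b lies in [0, 1]. *)
have intE := @Rintegral_step R (fun s => drift eta theta (B s w)) (T^~ w)
  (fun k => drift eta theta (b k w)) (`|eta| + `|theta|) (T0 w) (T_increasing^~ w).
have {}intE k' t' : T k' w <= t' <= T k'.+1 w ->
    \int[lebesgue_measure]_(s in `[0, t']) drift eta theta (B s w) =
    \sum_(i < k') drift eta theta (b i w) * (T i.+1 w - T i w) +
    drift eta theta (b k' w) * (t' - T k' w).
  apply: intE => {k' t'} [k' s /[dup] ks /andP[k's _]|k'].
    by rewrite BE ?(le_trans (arrival_ge0 k' w) k's)// (count_between ks).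
  rewrite /drift (le_trans (ler_normB _ _))// lerD2l normrM.
  have /andP[b0 b1] := b01 k'; rewrite ler_piMl// ger0_norm ?subr_ge0//.
  by rewrite lerBlDr lerDl.
move=> kt; have kk : T k w <= T k w <= T k.+1 w by rewrite lexx ltW ?T_increasing.
by rewrite /X /surplus !(ssiE _ k)// !(intE k)// !subrr !mulr0 !addr0 addrACA.
Qed.

Let Wc t := W (Num.max 0 t) w.

Let Y k s := drift eta theta (b k w) * s +
  volatility sigma (b k w) * (Wc (T k w + s) - W (T k w) w).

Let Y_continuous k : continuous (Y k).
Proof.
move=> s; apply: cvgD; first by apply: cvgM; [exact: cvg_cst|exact: cvg_id].
apply: cvgM; first exact: cvg_cst.
apply: cvgB; last exact: cvg_cst.
have h : T k w + x @[x --> s] --> T k w + s.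
  by apply: cvgD; [exact: cvg_cst|exact: cvg_id].
have cWc : continuous Wc := continuous_positive_part (@W_continuous w).
exact: (cvg_comp _ _ h (cWc (T k w + s))).
Qed.

Let X_shift k s : 0 <= s <= T k.+1 w - T k w -> X (T k w + s) = X (T k w) + Y k s.
Proof.
move=> /andP[s0 sk]; rewrite (@surplus_between k); last first.
  by rewrite lerDl s0/= -lerBrDl.
by rewrite (addrAC (T k w) s) subrr add0r /Y /Wc max_r// addr_ge0// arrival_ge0.
Qed.

Let X0 : X 0 = 0.
Proof.
rewrite /X /surplus set_itv1 Rintegral_set1 add0r.
rewrite /simple_stochastic_integral (@count_between 0%N) ?T0 ?lexx//=; last first.
  by have := T_increasing 0%N w; rewrite T0.
rewrite big_ord1 T0 min_r ?subrr ?mulr0//.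
by rewrite (le_trans _ (ltW (T_increasing 0%N w)))// T0.
Qed.

Lemma drawdown_start z : 0 <= z -> drawdown eta theta sigma W N T B z 0 w = z.
Proof.
move=> z0; rewrite /drawdown -/(X 0) X0 subr0 set_itv1 image_set1 sup1 -/(X 0) X0.
by rewrite max_l.
Qed.

Let Y_bounded k t : 0 <= t -> has_ubound [set Y k s | s in `[0, t]].
Proof.
move=> t0; have [|c _ cmax] := EVT_max t0 (f := Y k).
  by apply: continuous_subspaceT => x; exact: Y_continuous.
by exists (Y k c) => _ [s sI <-]; exact: cmax.
Qed.

Let gap_ge0 k : 0 <= T k.+1 w - T k w.
Proof. by rewrite subr_ge0 ltW ?T_increasing. Qed.

Let X_bounded k : has_ubound [set X s | s in `[0, T k w]].
Proof.
elim: k => [|k [M1 M1P]].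
  by rewrite T0 set_itv1 image_set1; exists (X 0) => _ ->.
have [M2 M2P] := @Y_bounded k _ (gap_ge0 k).
exists (Num.max M1 (X (T k w) + M2)) => _ [s + <-].
rewrite /= in_itv/= => /andP[s0 sk].
rewrite le_max; have [sTk|Tks] := leP s (T k w).
  by rewrite M1P//; exists s => //=; rewrite in_itv/= s0.
have sI : 0 <= s - T k w <= T k.+1 w - T k w by rewrite subr_ge0 (ltW Tks) lerD2r.
rewrite -(subrKC (T k w) s) X_shift// lerD2l M2P ?orbT//.
by exists (s - T k w).
Qed.

(** The supremum up to [T k.+1] is the larger of the supremum up to [T k] and [X (T k)] plus the
    supremum of [Y k] over the gap. Subtracting [X (T k)] turns the first, together with [z], into
    the drawdown at [T k], which acts as a new initial drawdown. *)
Lemma drawdown_step z k (p : path_space R (nat * nat)%type) :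
  (forall n j, dyadic n j <= T k.+1 w - T k w ->
    p (n, j) = shifted_path (T k) w (n, j)) ->
  drawdown eta theta sigma W N T B z (T k.+1 w) w =
  drawdown_map eta theta sigma (drawdown eta theta sigma W N T B z (T k w) w)
    (b k w) (T k.+1 w - T k w) p.
Proof.
move=> pE; rewrite (@drawdown_mapE _ _ _ _ _ _ _ _ (Y k))//; first last.
- move=> n j nj; rewrite pE// /Y /shifted_path/= /Wc max_r//.
  by rewrite addr_ge0 ?arrival_ge0 ?dyadic_ge0.
rewrite /drawdown -!/(X _).
have -> : X (T k.+1 w) = X (T k w) + Y k (T k.+1 w - T k w).
  by rewrite -X_shift ?lexx ?gap_ge0// subrKC.
set Sk := sup [set X s | s in `[0, T k w]].
set SY := sup [set Y k s | s in `[0, T k.+1 w - T k w]].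
have -> : sup [set X s | s in `[0, T k.+1 w]] = Num.max Sk (X (T k w) + SY).
  have kk := ltW (T_increasing k w).
  apply/le_anti/andP; split.
    apply: sup_le_ub.
      by exists (X 0), 0 => //=; rewrite in_itv/= lexx arrival_ge0.
    move=> _ [s + <-]; rewrite /= in_itv/= => /andP[s0 sk].
    rewrite le_max; have [sTk|Tks] := leP s (T k w).
      by rewrite ub_le_sup//; exists s => //=; rewrite in_itv/= s0.
    have sI : 0 <= s - T k w <= T k.+1 w - T k w.
      by rewrite subr_ge0 (ltW Tks) lerD2r.
    apply/orP; right; rewrite -(subrKC (T k w) s) X_shift// lerD2l.
    by apply: ub_le_sup; [exact: Y_bounded|exists (s - T k w)].
  rewrite ge_max; apply/andP; split.
    apply: sup_le_ub.
      by exists (X 0), 0 => //=; rewrite in_itv/= lexx arrival_ge0.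
    move=> _ [s + <-]; rewrite /= in_itv/= => /andP[s0 sk].
    apply: ub_le_sup => //; exists s => //=.
    by rewrite in_itv/= s0 (le_trans sk).
  rewrite -lerBrDl; apply: sup_le_ub.
    by exists (Y k 0), 0 => //=; rewrite in_itv/= lexx gap_ge0.
  move=> _ [s + <-]; rewrite /= in_itv/= => sI; rewrite lerBrDl -X_shift//.
  apply: ub_le_sup => //; exists (T k w + s) => //=.
  move: sI => /andP[s0 sk]; rewrite in_itv/= addr_ge0 ?arrival_ge0//=.
  by rewrite -lerBrDl.
by rewrite maxA opprD addrA addr_maxl [X in Num.max _ X - _]addrAC subrr add0r.
Qed.

Lemma drawdown_arrival_ge0 z k : 0 <= z ->
  0 <= drawdown eta theta sigma W N T B z (T k w) w.
Proof.
move=> z0; rewrite /drawdown subr_ge0 le_max; apply/orP; right.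
apply: ub_le_sup; first exact: X_bounded.
by exists (T k w) => //=; rewrite in_itv/= lexx arrival_ge0.
Qed.

End drawdown_recursion.

(** * The joint filtration at the arrival times *)

Section sigma_algebra_facts.
Context {disp : measure_display} {Om : measurableType disp}.
Implicit Types (G H : set (set Om)).

Lemma sigma_algebra_setI G : sigma_algebra setT G -> setI_closed G.
Proof.
move=> sG A B; rewrite -(measurable_g_measurableTypeE sG) => mA mB.
exact: measurableI.
Qed.

Lemma sigma_algebra_setC G A : sigma_algebra setT G -> G A -> G (~` A).
Proof. by move=> [_ GC _] GA; rewrite -setTD; exact: GC. Qed.

(** Adaptedness is treated as measurability on a copy of [Om] that carries the smaller
    sigma-algebra; closure properties of measurable functions then apply to adapted quantities. *)
Lemma sub_measurableP d (E : measurableType d) G (X : Om -> E) :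
  sigma_algebra setT G ->
  sub_measurable G X <-> measurable_fun setT (X : g_sigma_algebraType G -> E).
Proof.
move=> sG; split => [GX _ A mA|mX A mA].
  by rewrite setTI measurable_g_measurableTypeE//; exact: GX.
by have := mX measurableT A mA; rewrite setTI measurable_g_measurableTypeE.
Qed.

Lemma measurable_fun_sub d (E : measurableType d) G H (X : Om -> E) :
  G `<=` H -> measurable_fun setT (X : g_sigma_algebraType G -> E) ->
  measurable_fun setT (X : g_sigma_algebraType H -> E).
Proof.
by move=> GH mX _ A mA; apply: (sub_sigma_algebra2 GH); exact: mX.
Qed.

Lemma measurable_fun_of_sub d (E : measurableType d) G (X : Om -> E) :
  sigma_algebra setT G -> G `<=` measurable ->
  measurable_fun setT (X : g_sigma_algebraType G -> E) -> measurable_fun setT X.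
Proof.
move=> sG mG mX _ A mA; apply: mG.
by have := mX measurableT A mA; rewrite measurable_g_measurableTypeE.
Qed.

End sigma_algebra_facts.

Section arrival_filtration.
Context {R : realType} {disp : measure_display} {Om : measurableType disp}.
Variables (eta theta sigma : R).
Variables (W : R -> Om -> R) (N : R -> Om -> nat) (T : nat -> Om -> R).
Hypothesis W_measurable : forall t, 0 <= t -> measurable_fun setT (W t).
Hypothesis N_measurable : forall t, 0 <= t -> measurable_fun setT (N t).
Hypothesis W_continuous :
  forall w, {within [set t : R | 0 <= t], continuous (fun t => W t w)}.
Hypothesis T0 : forall w, T 0%N w = 0.
Hypothesis T_increasing : forall k w, T k w < T k.+1 w.
Hypothesis T_count : forall t w k, 0 <= t -> (T k w <= t) = (k <= N t w)%N.

(** Raw past of (W, N), given by generators. The joint filtration, an intersection over competing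
    filtrations, has no generators to argue with. *)
Definition joint_past (s : R) : set (set Om) :=
  <<s [set A | exists u, 0 <= u <= s /\
    ((exists2 C : set R, measurable C & A = W u @^-1` C) \/
     (exists C : set nat, A = N u @^-1` C))] >>.

Lemma joint_past_measurable s : joint_past s `<=` measurable.
Proof.
apply: smallest_sub; first exact: sigma_algebra_measurable.
move=> _ [u [/andP[u0 _] [[C mC ->]|[C ->]]]].
  exact: measurable_preim (W_measurable u0) mC.
exact: measurable_preim (N_measurable u0) _.
Qed.

Lemma joint_filtration_sub_past t s : 0 <= t -> t < s ->
  joint_filtration W N t `<=` joint_past s.
Proof.
move=> t0 ts A /(_ (fun t => \bigcap_(s in [set s | t < s]) joint_past s)).
apply => //.
- split.
  + move=> u _; apply: sigma_algebra_bigcap => v _.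
    exact: smallest_sigma_algebra.
  + move=> u _ B /(_ (u + 1)) => h; apply: (@joint_past_measurable (u + 1)).
    by apply: h; rewrite /= ltrDl.
  + by move=> u v _ uv B h x /= vx; apply: h => /=; exact: le_lt_trans vx.
- move=> u _ B h v /= uv.
  have [uh hv] := midf_lt uv.
  by apply: (h _ uh).
- move=> u u0 C mC v /= uv; apply: sub_sigma_algebra.
  by exists u; split; [rewrite u0 ltW|left; exists C].
- move=> u u0 C mC v /= uv; apply: sub_sigma_algebra.
  by exists u; split; [rewrite u0 ltW|right; exists C].
Qed.

Lemma joint_filtration_sigma_algebra t : 0 <= t ->
  sigma_algebra setT (joint_filtration W N t).
Proof.
move=> t0; split.
- by move=> F [/(_ t t0)[]].
- move=> A FA F fF rF aW aN; have [/(_ t t0)[_ FC _] _ _] := fF.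
  by apply: FC; exact: FA.
- move=> A FA F fF rF aW aN; have [/(_ t t0)[_ _ FU] _ _] := fF.
  by apply: FU => n; exact: FA.
Qed.

Lemma joint_filtration_measurable t : 0 <= t ->
  joint_filtration W N t `<=` measurable.
Proof.
move=> t0 A /(@joint_filtration_sub_past t (t + 1) t0).
by rewrite ltrDl => /(_ ltr01); exact: joint_past_measurable.
Qed.

Lemma joint_filtration_mono s t : 0 <= s -> s <= t ->
  joint_filtration W N s `<=` joint_filtration W N t.
Proof.
move=> s0 st A FA F fF rF aW aN; have [_ _ /(_ s t s0 st)] := fF; apply.
exact: FA.
Qed.

Lemma joint_filtration_W t C : 0 <= t -> measurable C ->
  joint_filtration W N t (W t @^-1` C).
Proof. by move=> t0 mC F _ _ aW _; exact: aW. Qed.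

Lemma joint_filtration_N t (C : set nat) : 0 <= t ->
  joint_filtration W N t (N t @^-1` C).
Proof. by move=> t0 F _ _ _ aN; exact: aN. Qed.

Definition arrival_sigma (k : nat) : set (set Om) :=
  stopped_sigma_algebra (joint_filtration W N) (T k).

Lemma arrival_le_mem k t : 0 <= t -> joint_filtration W N t [set w | T k w <= t].
Proof.
move=> t0; rewrite [X in joint_filtration _ _ _ X](_ : _ =
  N t @^-1` [set n | (k <= n)%N]); first exact: joint_filtration_N.
by apply/seteqP; split => w /=; rewrite T_count.
Qed.

Lemma arrival_sigma_algebra k : sigma_algebra setT (arrival_sigma k).
Proof.
split.
- move=> t t0; rewrite set0I.
  by have [] := joint_filtration_sigma_algebra t0.
- move=> A SA t t0; have sF := joint_filtration_sigma_algebra t0.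
  rewrite setTD [X in joint_filtration _ _ _ X](_ : _ =
    [set w | T k w <= t] `&` ~` (A `&` [set w | T k w <= t])).
    apply: (sigma_algebra_setI sF); first exact: arrival_le_mem.
    by apply: (sigma_algebra_setC sF); exact: SA.
  apply/seteqP; split => w /=; first by move=> [nA kt]; split => // -[].
  by move=> [kt h]; split => // Aw; apply: h.
- move=> A SA t t0; have [_ _ FU] := joint_filtration_sigma_algebra t0.
  by rewrite setI_bigcupl; apply: FU => n; exact: SA.
Qed.

Lemma measurable_arrival_sigmaE k :
  @measurable _ (g_sigma_algebraType (arrival_sigma k)) = arrival_sigma k.
Proof. by apply: measurable_g_measurableTypeE; exact: arrival_sigma_algebra. Qed.

Lemma arrival_sigma_measurable k : arrival_sigma k `<=` measurable.
Proof.
move=> A SA; rewrite (_ : A = \bigcup_n (A `&` [set w | T k w <= n%:R])).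
  apply: bigcupT_measurable => n.
  by apply: (@joint_filtration_measurable n%:R) => //; exact: SA.
apply/seteqP; split => w /=; last by move=> [n _ []].
move=> Aw; exists (Num.truncn (T k w)).+1 => //=; split => //.
by rewrite ltW// truncnS_gt.
Qed.

Lemma arrival_sigmaS k : arrival_sigma k `<=` arrival_sigma k.+1.
Proof.
move=> A SA t t0; rewrite (_ : A `&` _ =
  (A `&` [set w | T k w <= t]) `&` [set w | T k.+1 w <= t]).
  apply: (sigma_algebra_setI (joint_filtration_sigma_algebra t0)).
    exact: SA.
  exact: arrival_le_mem.
apply/seteqP; split => w /=; last by move=> [[]].
by move=> [Aw kt]; split => //; split => //; apply: le_trans kt; exact: ltW.
Qed.

Lemma measurable_arrival k :
  measurable_fun setT (T k : g_sigma_algebraType (arrival_sigma k) -> R).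
Proof.
apply: (measurability _ (RGenOInfty.measurableE R)) => _ [_ [a ->] <-].
rewrite setTI measurable_arrival_sigmaE.
rewrite (_ : _ @^-1` _ = ~` [set w | T k w <= a]); last first.
  by apply/seteqP; split => w /=; rewrite in_itv/= andbT ltNge => /negP.
apply: (sigma_algebra_setC (arrival_sigma_algebra k)) => t t0.
have [a0|a0] := ltP a 0.
  rewrite (_ : _ `&` _ = set0); first by have [] := joint_filtration_sigma_algebra t0.
  apply/seteqP; split => w //= [Ta _].
  by have := le_lt_trans Ta a0; rewrite ltNge (arrival_ge0 T0 T_increasing).
have m0 : 0 <= Num.min a t by rewrite le_min a0.
rewrite (_ : _ `&` _ = [set w | T k w <= Num.min a t]).
  apply: (joint_filtration_mono m0); first by rewrite ge_min lexx orbT.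
  exact: arrival_le_mem.
by apply/seteqP; split => w /=; rewrite le_min => /andP.
Qed.

(** By continuity, [W] at time [S] is the limit of its values at dyadic times below [S]. The
    approximation is from below so that on the event that [T k] is at most t only values of [W] up
    to time t occur, since [S] is at most [T k]. *)
Lemma measurable_W_at k (S : Om -> R) : (forall w, 0 <= S w <= T k w) ->
  measurable_fun setT (S : g_sigma_algebraType (arrival_sigma k) -> R) ->
  measurable_fun setT
    ((fun w => W (S w) w) : g_sigma_algebraType (arrival_sigma k) -> R).
Proof.
move=> S0T mS.
apply: (@measurable_fun_cvg _ (g_sigma_algebraType (arrival_sigma k)) R setT
  (fun n w => W (dyadic n (dyadic_index n (S w))) w)); last first.
  move=> w _; have /andP[S0 _] := S0T w.
  have cW := continuous_positive_part (@W_continuous w).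
  have h := @cvg_dyadic_index R 0 _ S0.
  have {}h : dyadic n (dyadic_index n (S w)) @[n --> \oo] --> S w.
    by under eq_fun do rewrite -[dyadic_index _ _]addn0.
  have {cW} := cvg_comp _ _ h (cW (S w)).
  rewrite /= max_r//; apply: cvg_trans; apply: near_eq_cvg; near=> n => /=.
  by rewrite max_r// dyadic_ge0.
move=> n _ C mC; rewrite setTI measurable_arrival_sigmaE => t t0.
have sF := joint_filtration_sigma_algebra t0.
rewrite (_ : _ `&` _ = \bigcup_j
    (([set w | dyadic_index n (S w) = j] `&` [set w | T k w <= t]) `&`
      W (dyadic n j) @^-1` C)); last first.
  apply/seteqP; split => w /=.
    by move=> [WC kt]; exists (dyadic_index n (S w)).
  by move=> [j _ [[<- kt]]].
have [F0 _ FU] := sF; apply: FU => j.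
have [jt|tj] := leP (dyadic n j) t.
  apply: (sigma_algebra_setI sF).
    have : @measurable _ (g_sigma_algebraType (arrival_sigma k))
        (S @^-1` [set s | dyadic_index n s = j]).
      rewrite -[X in measurable X]setTI; apply: mS => //.
      exact: measurable_dyadic_index.
    by rewrite measurable_arrival_sigmaE; exact.
  apply: (joint_filtration_mono _ jt); first exact: dyadic_ge0.
  by apply: joint_filtration_W => //; exact: dyadic_ge0.
rewrite (_ : _ `&` _ = set0)//; apply/seteqP; split => w //= -[[Sj kt] _].
have /andP[S0 ST] := S0T w.
rewrite -Sj in tj.
have := lt_le_trans tj (le_trans (dyadic_index_le n S0) (le_trans ST kt)).
by rewrite ltxx.
Unshelve. all: by end_near. Qed.

(* Up to the next arrival this is [shifted_path W (T k)], so both paths give the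
   same drawdown at [T k.+1]; but this one does not look beyond [T k.+1]. *)
Definition stopped_path (k : nat) (w : Om) : path_space R (nat * nat)%type :=
  fun i => W (Num.min (T k w + dyadic i.1 i.2) (T k.+1 w)) w - W (T k w) w.

Lemma measurable_stopped_path k : measurable_fun setT
  (stopped_path k : g_sigma_algebraType (arrival_sigma k.+1) -> _).
Proof.
have mT := measurable_fun_sub (arrival_sigmaS (k := k)) (measurable_arrival (k := k)).
apply: measurable_to_path => i; apply: measurable_funB.
  apply: measurable_W_at => [w|].
    rewrite ge_min lexx orbT le_min (arrival_ge0 T0 T_increasing) andbT.
    by rewrite addr_ge0 ?dyadic_ge0// (arrival_ge0 T0 T_increasing).
  apply: measurable_minr; last exact: measurable_arrival.
  exact: measurable_funD.
apply: measurable_W_at => // w.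
by rewrite (arrival_ge0 T0 T_increasing) ltW.
Qed.

Lemma measurable_drawdown_next k (z b : Om -> R) :
  measurable_fun setT (z : g_sigma_algebraType (arrival_sigma k) -> R) ->
  measurable_fun setT (b : g_sigma_algebraType (arrival_sigma k) -> R) ->
  measurable_fun setT
    ((fun w => drawdown_map eta theta sigma (z w) (b w) (T k.+1 w - T k w)
      (stopped_path k w)) : g_sigma_algebraType (arrival_sigma k.+1) -> R).
Proof.
move=> mz mb; apply: measurable_drawdown_map.
- exact: measurable_fun_sub (arrival_sigmaS (k := k)) mz.
- exact: measurable_fun_sub (arrival_sigmaS (k := k)) mb.
- apply: measurable_funB; first exact: measurable_arrival.
  exact: measurable_fun_sub (arrival_sigmaS (k := k)) (measurable_arrival (k := k)).
- exact: measurable_stopped_path.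
Qed.

Section strategy.
Variables (B : R -> Om -> R) (b : nat -> Om -> R).
Hypothesis b01 : forall k w, 0 <= b k w <= 1.
Hypothesis BE : forall t w, 0 <= t -> B t w = b (N t w) w.

Lemma drawdown_stopped_step z k w :
  drawdown eta theta sigma W N T B z (T k.+1 w) w =
  drawdown_map eta theta sigma (drawdown eta theta sigma W N T B z (T k w) w)
    (b k w) (T k.+1 w - T k w) (stopped_path k w).
Proof.
apply: (drawdown_step eta theta sigma W_continuous T0 T_increasing T_count
  (b01^~ w)) => [t|n j nj].
  exact: BE.
by rewrite /stopped_path /shifted_path min_l// -lerBrDl.
Qed.

(** Companion of [drawdown_stopped_step]: the stopped path shows that the next drawdown is adapted,
    while this path belongs to the block that is independent of the past. *)
Lemma drawdown_shifted_step z k w :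
  drawdown eta theta sigma W N T B z (T k.+1 w) w =
  drawdown_map eta theta sigma (drawdown eta theta sigma W N T B z (T k w) w)
    (b k w) (T k.+1 w - T k w) (shifted_path W (T k) w).
Proof.
by apply: (drawdown_step eta theta sigma W_continuous T0 T_increasing T_count
  (b01^~ w)) => // t; exact: BE.
Qed.

Lemma measurable_drawdown_arrival z k : 0 <= z ->
  (forall k, measurable_fun setT
     (b k : g_sigma_algebraType (arrival_sigma k) -> R)) ->
  measurable_fun setT ((fun w => drawdown eta theta sigma W N T B z (T k w) w) :
    g_sigma_algebraType (arrival_sigma k) -> R).
Proof.
move=> z0 mb; elim: k => [|k IH].
  rewrite (_ : (fun w => _) = cst z)//; apply/funext => w; rewrite T0.
  exact: (drawdown_start eta theta sigma W T0 T_increasing T_count).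
rewrite (_ : (fun w => _) = fun w => drawdown_map eta theta sigma
  (drawdown eta theta sigma W N T B z (T k w) w)
  (b k w) (T k.+1 w - T k w) (stopped_path k w)).
  exact: measurable_drawdown_next.
by apply/funext => w; exact: drawdown_stopped_step.
Qed.

End strategy.

End arrival_filtration.

(** By uniqueness of product measures the rectangle identity makes the law of (U, X) the product of
    the laws of [U] and [Y]; Tonelli's theorem does the rest. This takes the place of conditional
    expectations. *)
Lemma integral_factorization (R : realType) d (Om : measurableType d)
    (P : probability Om R) d1 d2 (E1 : measurableType d1)
    (E2 : measurableType d2) (U : Om -> E1) (X Y : Om -> E2)
    (f : E1 * E2 -> \bar R) :
  measurable_fun setT U -> measurable_fun setT X -> measurable_fun setT Y ->
  (forall A C, measurable A -> measurable C ->
    P (U @^-1` A `&` X @^-1` C) = P (U @^-1` A) * P (Y @^-1` C))%E ->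
  measurable_fun setT f -> (forall x, 0 <= f x)%E ->
  (\int[P]_w f (U w, X w) = \int[P]_w \int[P]_w' f (U w, Y w'))%E.
Proof.
move=> mU mX mY UXY mf f0.
have mUX : measurable_fun setT (fun w => (U w, X w)) by exact: measurable_fun_pair.
pose U' : {mfun Om >-> E1} := HB.pack U (isMeasurableFun.Build _ _ _ _ _ mU).
pose Y' : {mfun Om >-> E2} := HB.pack Y (isMeasurableFun.Build _ _ _ _ _ mY).
pose UX' : {mfun Om >-> (E1 * E2)%type} := HB.pack (fun w => (U w, X w))
  (isMeasurableFun.Build _ _ _ _ _ mUX).
have E : forall D, measurable D ->
    (distribution P U' \x distribution P Y')%E D = distribution P UX' D.
  by apply: product_measure_unique => A C mA mC; rewrite -UXY.
rewrite -(@ge0_integral_distribution _ _ _ _ _ P UX' f mf f0).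
rewrite (eq_measure_integral (distribution P U' \x distribution P Y')%E); last first.
  by move=> D mD _; exact: (esym (E D mD)).
rewrite fubini_tonelli1// ge0_integral_distribution//; first last.
- by move=> x; exact: integral_ge0.
- exact: measurable_fun_fubini_tonelli_F.
apply: eq_integral => w _ /=; rewrite /fubini_F.
rewrite ge0_integral_distribution//.
by apply: measurableT_comp => //; exact: pair1_measurable.
Qed.

Section process_sigma.
Context {R : realType} {disp : measure_display} {Om : measurableType disp}.

Lemma process_sigma_algebra_mono d (E : measurableType d) (X : R -> Om -> E)
    (I J : set R) : I `<=` J ->
  process_sigma_algebra X I `<=` process_sigma_algebra X J.
Proof.
by move=> IJ; apply: sub_sigma_algebra2 => A [t It XA]; exists t => //; exact: IJ.
Qed.

Lemma process_sigma_algebra_measurable d (E : measurableType d)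
    (X : R -> Om -> E) (I : set R) :
  (forall t, I t -> measurable_fun setT (X t)) ->
  process_sigma_algebra X I `<=` measurable.
Proof.
move=> mX; apply: smallest_sub; first exact: sigma_algebra_measurable.
by move=> _ [t It [C mC <-]]; exact: mX.
Qed.

Lemma measurable_process d (E : measurableType d) (X : R -> Om -> E) (I : set R)
    (G : set (set Om)) t : I t -> process_sigma_algebra X I `<=` <<s G >> ->
  measurable_fun setT (X t : g_sigma_algebraType G -> E).
Proof.
move=> It XG _ C mC; apply: XG; apply: sub_sigma_algebra.
by exists t => //; exists C.
Qed.

End process_sigma.

Section law_limit.
Context {R : realType} {disp : measure_display} {Om : measurableType disp}.
Variable P : probability Om R.

(** Finitely many strict inequalities between coordinates and thresholds persist along a pointwise
    convergent sequence, whereas membership in a general measurable set does not. Hence the test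
    sets are boxes of open half-lines. *)
Lemma factorization_limit (I : eqType) (V_ : nat -> Om -> path_space R I)
    (V Y : Om -> path_space R I) (A : set Om) :
  measurable A -> (forall n, measurable_fun setT (V_ n)) ->
  measurable_fun setT V -> measurable_fun setT Y ->
  (forall w i, V_ n w i @[n --> \oo] --> V w i) ->
  (forall n C, measurable C ->
    P (A `&` V_ n @^-1` C) = P A * P (Y @^-1` C))%E ->
  forall C, measurable C -> (P (A `&` V @^-1` C) = P A * P (Y @^-1` C))%E.
Proof.
move=> mA mV_ mV mY cV PV_.
pose K := [set C : set R | exists x, C = `]-oo, x[%classic].
have KI : setI_closed K.
  move=> _ _ [x ->] [y ->]; exists (Num.min x y).
  by apply/seteqP; split => z /=; rewrite !in_itv/= lt_min => /andP.
apply: (factorization_dynkin mA mV mY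
  (path_space_measurableE (RGenInftyO.measurableE R)) (boxes_setI_closed KI)).
move=> _ [J [C [/choice[a aE] ->]]].
pose S e : set (path_space R I) := box J (fun i => `]-oo, a i - e[%classic).
have -> : box J C = S 0.
  by apply: eq_set => p; apply: eq_forall => i; rewrite aE subr0.
have mS e : measurable (S e).
  by apply: sub_sigma_algebra; exists J, (fun i => `]-oo, a i - e[%classic).
have SE e p : S e p <-> forall i, i \in J -> p i < a i - e.
  by split => h i /h/=; rewrite in_itv.
have mAV e : measurable (A `&` V @^-1` S e).
  by apply: measurableI => //; exact: measurable_preim.
have mAV_ n e : measurable (A `&` V_ n @^-1` S e).
  by apply: measurableI => //; exact: measurable_preim.
(* Fatou's lemma gives one inequality from the open boxes and, at the slightly
   lower thresholds [a - e], the other one from their complements. *)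
apply/le_anti/andP; split.
  apply: (@prob_liminf_le _ _ _ P _ (fun n => A `&` V_ n @^-1` S 0)) => //.
    move=> w [Aw /SE VS].
    suff : \forall n \near \oo, forall i, i \in J -> V_ n w i < a i - 0.
      by apply: filterS => n h; split => //; apply/SE.
    elim: J {S mS SE mAV mAV_} VS => [|j J IH] VS; first exact: nearW.
    have h1 : \forall n \near \oo, V_ n w j < a j - 0.
      by apply: (cvgr_lt _ (cV w j)); apply: VS; rewrite mem_head.
    have h2 := IH (fun i iJ => VS i (introT orP (or_intror iJ))).
    near=> n => i; rewrite inE => /predU1P[->|iJ]; first by near: n.
    by move: i iJ; near: n.
  by move=> n; rewrite PV_.
have lower e : 0 < e -> (P A * P (Y @^-1` S e) <= P (A `&` V @^-1` S 0%R))%E.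
  move=> e0.
  have h : (P (A `&` ~` (V @^-1` S 0%R)) <= P A - P A * P (Y @^-1` S e))%E.
    apply: (@prob_liminf_le _ _ _ P _ (fun n => A `&` ~` (V_ n @^-1` S e))).
    - by apply: measurableI => //; apply: measurableC; exact: measurable_preim.
    - by move=> n; apply: measurableI => //; apply: measurableC; exact: measurable_preim.
    - move=> w [Aw /= nS].
      have [i iJ Vi] : exists2 i, i \in J & a i - e < V w i.
        apply: contra_notP nS => nex; apply/SE => i iJ; rewrite subr0.
        rewrite ltNge; apply/negP => aV; apply: nex; exists i => //.
        by rewrite ltrBlDr (le_lt_trans aV)// ltrDl.
      have : \forall n \near \oo, a i - e < V_ n w i by exact: (cvgr_gt _ (cV w i)).
      apply: filterS => n ain; split => // /SE /(_ i iJ).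
      by rewrite ltNge ltW.
    - by move=> n; rewrite prob_setIC// ?PV_//; exact: measurable_preim.
  move: h; rewrite prob_setIC//; last exact: measurable_preim.
  have fA := fin_num_prob P mA.
  have fAV := fin_num_prob P (mAV 0).
  have fY := fin_num_prob P (measurable_preim mY (mS e)).
  rewrite -(fineK fA) -(fineK fAV) -(fineK fY) -EFinM -!EFinB !lee_fin.
  by rewrite lerD2l lerN2.
(* If [P A] is positive, [lower] is divided by it and used with e = 1 / (n + 1); every path in [S 0]
   eventually lies in these smaller boxes. *)
have [PA0|PA0] := eqVneq (P A) 0%E; first by rewrite PA0 mul0e.
have fA := fin_num_prob P mA.
have fAV := fin_num_prob P (mAV 0).
have PA_gt0 : 0 < fine (P A).
  by apply: fine_gt0; rewrite lt0e PA0 measure_ge0/= -ge0_fin_numE.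
rewrite -(fineK fA) -lee_pdivlMl//.
apply: (@prob_liminf_le _ _ _ P _ (fun n => Y @^-1` S (n.+1%:R^-1))).
- exact: measurable_preim.
- by move=> n; exact: measurable_preim.
- move=> w /SE YS.
  suff : \forall n \near \oo, forall i, i \in J -> Y w i < a i - n.+1%:R^-1.
    by apply: filterS => n h; apply/SE.
  elim: J {S mS SE mAV mAV_ lower fAV} YS => [|j J IH] YS; first exact: nearW.
  have h1 : \forall n \near \oo, Y w j < a j - n.+1%:R^-1.
    have Yj : Y w j < a j by rewrite -[a j]subr0 YS// mem_head.
    have := near_infty_natSinv_lt (PosNum (eqbRL (subr_gt0 _ _) Yj)).
    by apply: filterS => n /=; rewrite ltrBrDr addrC -ltrBrDr.
  have h2 := IH (fun i iJ => YS i (introT orP (or_intror iJ))).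
  near=> n => i; rewrite inE => /predU1P[->|iJ]; first by near: n.
  by move: i iJ; near: n.
- move=> n; rewrite lee_pdivlMl// fineK//.
  by apply: lower; rewrite invr_gt0.
Unshelve. all: by end_near. Qed.

End law_limit.

(** * The strong Markov property at the arrival times *)

Section brownian_restart.
Context {R : realType} {disp : measure_display} {Om : measurableType disp}.
Variables (P : probability Om R) (W : R -> Om -> R).
Hypothesis W_brownian : standard_brownian_motion P W.

Let W_measurable := bm_measurable W_brownian.

Lemma brownian_sigma_measurable (I : set R) : I `<=` [set t | 0 <= t] ->
  process_sigma_algebra W I `<=` measurable.
Proof.
by move=> I0; apply: process_sigma_algebra_measurable => t /I0 /W_measurable.
Qed.

Lemma increment_mem (s u v : R) (C : set R) : 0 <= u <= s -> 0 <= v <= s ->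
  measurable C ->
  process_sigma_algebra W `[0, s] ((fun w => W v w - W u w) @^-1` C).
Proof.
move=> us vs mC.
pose G := \bigcup_(t in `[0, s]) preimage_set_system setT (W t) measurable.
have h t : 0 <= t <= s ->
    measurable_fun setT (W t : g_sigma_algebraType G -> R).
  by move=> ts; apply: (@measurable_process _ _ _ _ _ W `[0, s] G t) => //=;
    rewrite in_itv.
have m : measurable_fun setT ((fun w => W v w - W u w) : g_sigma_algebraType G -> R).
  by apply: measurable_funB; exact: h.
by have := m measurableT C mC; rewrite setTI.
Qed.

(** The membership claim is part of the induction: it places the first m increments in the past of
    the next one, which is then independent of them. *)
Lemma brownian_increments (h t : R) (A : set Om) (C : nat -> set R) (m : nat) :
  0 < h -> 0 <= t -> process_sigma_algebra W `[0, t] A ->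
  (forall i, measurable (C i)) ->
  let S := A `&` [set w | forall i, (i < m)%N ->
    C i (W (t + i.+1%:R * h) w - W (t + i%:R * h) w)] in
  process_sigma_algebra W `[0, t + m%:R * h] S /\
  (P S = P A * \prod_(i < m) normal_prob 0 (Num.sqrt h) (C i))%E.
Proof.
move=> h0 t0 FA mC; elim: m => [|m [FS PS]] S.
  have -> : S = A by apply/seteqP; split => w //= [].
  by rewrite mul0r addr0 big_ord0 mule1.
pose S' := A `&` [set w | forall i, (i < m)%N ->
    C i (W (t + i.+1%:R * h) w - W (t + i%:R * h) w)].
have {FS PS} [FS PS] : process_sigma_algebra W `[0, t + m%:R * h] S' /\
  (P S' = P A * \prod_(i < m) normal_prob 0 (Num.sqrt h) (C i))%E by [].
have SE : S = S' `&`
    ((fun w => W (t + m.+1%:R * h) w - W (t + m%:R * h) w) @^-1` C m).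
  apply/seteqP; split => w /=.
    move=> [Aw Cw]; split; last exact: Cw.
    by split => // i im; apply: Cw; rewrite ltnS ltnW.
  move=> [[Aw Cw] Cm]; split => // i; rewrite ltnS leq_eqVlt => /predU1P[->//|].
  exact: Cw.
have m0 : 0 <= t + m%:R * h by rewrite addr_ge0// mulr_ge0// ltW.
have mm : t + m%:R * h < t + m.+1%:R * h by rewrite ltrD2l ltr_pM2r// ltr_nat.
split; rewrite SE.
  apply: (sigma_algebra_setI (smallest_sigma_algebra _ _)).
    move: FS; apply: process_sigma_algebra_mono => x /=.
    by rewrite !in_itv/= => /andP[-> /=] /le_trans; apply; exact: ltW.
  apply: increment_mem => //; first by rewrite m0 ltW.
  by rewrite lexx andbT (le_trans m0)// ltW.
have IC : preimage_set_system setT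
    (fun w => W (t + m.+1%:R * h) w - W (t + m%:R * h) w) measurable
    ((fun w => W (t + m.+1%:R * h) w - W (t + m%:R * h) w) @^-1` C m).
  by exists (C m); rewrite ?setTI.
rewrite (bm_independent_increments W_brownian m0 mm FS IC).
rewrite PS (bm_normal_increments W_brownian m0 mm)// big_ord_recr/= muleA.
suff -> : t + m.+1%:R * h - (t + m%:R * h) = h by [].
by rewrite -natr1; ring.
Qed.

Let grid_increments (h t : R) (w : Om) : path_space R nat :=
  fun i => W (t + i.+1%:R * h) w - W (t + i%:R * h) w.

Let measurable_grid_increments h t : 0 <= h -> 0 <= t ->
  measurable_fun setT (grid_increments h t).
Proof.
move=> h0 t0; apply: measurable_to_path => i.
by apply: measurable_funB; apply: W_measurable; rewrite addr_ge0// mulr_ge0.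
Qed.

(** The product formula for the increments does not involve [t], so its instance at time 0 with the
    sure event identifies the factor beside [P A]. *)
Let grid_increments_law (h t : R) (A : set Om) (C : set (path_space R nat)) :
  0 < h -> 0 <= t -> process_sigma_algebra W `[0, t] A -> measurable C ->
  (P (A `&` grid_increments h t @^-1` C) =
   P A * P (grid_increments h 0 @^-1` C))%E.
Proof.
move=> h0 t0 FA mC.
have I0 : `[0, t] `<=` [set t | 0 <= t] by move=> x /=; rewrite in_itv => /andP[].
have mA := brownian_sigma_measurable I0 FA.
apply: (factorization_dynkin mA _ _ path_space_measurable_boxes) mC.
- exact: measurable_grid_increments (ltW h0) t0.
- exact: measurable_grid_increments (ltW h0) (lexx _).
- by apply: boxes_setI_closed => A1 A2; exact: measurableI.
move=> _ [J [D [mD ->]]].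
(* Consecutive increments up to the largest index in [J] are considered; those outside [J] are left
   unconstrained. *)
pose m := (\max_(i <- J) i).+1.
pose D' i := if i \in J then D i else setT.
have mD' i : measurable (D' i) by rewrite /D'; case: ifP.
have DE t' : grid_increments h t' @^-1` box J D = [set w | forall i, (i < m)%N ->
    D' i (W (t' + i.+1%:R * h) w - W (t' + i%:R * h) w)].
  apply/seteqP; split => w /= Dw i.
    by move=> _; rewrite /D'; case: ifPn => // iJ; exact: Dw.
  move=> iJ; have := Dw i; rewrite /D' iJ; apply.
  by rewrite ltnS; exact: leq_bigmax_seq.
have FT : process_sigma_algebra W `[0, 0] setT.
  rewrite -setC0; apply: (sigma_algebra_setC (smallest_sigma_algebra _ _)).
  exact: sigma_algebra0.
have [_ h1] := brownian_increments m h0 t0 FA mD'.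
have [_ h2] := brownian_increments m h0 (lexx _) FT mD'.
by rewrite !DE h1; move: h2; rewrite setTI probability_setT mul1e => ->.
Qed.

Lemma measurable_shifted_path t : 0 <= t ->
  measurable_fun setT (shifted_path W (fun=> t)).
Proof.
move=> t0; apply: measurable_to_path => i.
by apply: measurable_funB; apply: W_measurable => //; rewrite addr_ge0// dyadic_ge0.
Qed.

(** The finitely many dyadic times in a box lie on one grid, that of the largest level [M]. There
    the path values are partial sums of grid increments, so the box is an event about these
    increments. *)
Lemma brownian_restart (t : R) (A : set Om)
    (C : set (path_space R (nat * nat)%type)) :
  0 <= t -> process_sigma_algebra W `[0, t] A -> measurable C ->
  (P (A `&` shifted_path W (fun=> t) @^-1` C) =
   P A * P (shifted_path W (fun=> 0%R) @^-1` C))%E.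
Proof.
move=> t0 FA mC.
have I0 : `[0, t] `<=` [set t | 0 <= t] by move=> x /=; rewrite in_itv => /andP[].
have mA := brownian_sigma_measurable I0 FA.
apply: (factorization_dynkin mA _ _ path_space_measurable_boxes) mC.
- exact: measurable_shifted_path.
- exact: measurable_shifted_path.
- by apply: boxes_setI_closed => A1 A2; exact: measurableI.
move=> _ [J [D [mD ->]]].
pose M := \max_(i <- J) i.1.
pose h : R := dyadic M 1.
have h0 : 0 < h by rewrite /h /dyadic divr_gt0// exprn_gt0.
pose D' := [set x : path_space R nat | forall i, i \in J ->
  D i (\sum_(l < i.2 * 2 ^ (M - i.1)) x l)].
have mD' : measurable D'.
  rewrite (_ : D' = \bigcap_(i in [set` J])
    ((fun x : path_space R nat => \sum_(l < i.2 * 2 ^ (M - i.1)) x l) @^-1` D i))//.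
  apply: fin_bigcap_measurable => [|i _]; first exact: finite_seq.
  have mf : measurable_fun setT
      (fun x : path_space R nat => \sum_(l < i.2 * 2 ^ (M - i.1)) x l).
    by apply: measurable_sum => l; exact: measurable_path_eval.
  by rewrite -[X in measurable X]setTI; exact: mf.
have DE t' : shifted_path W (fun=> t') @^-1` box J D = grid_increments h t' @^-1` D'.
  have E w i : i \in J -> shifted_path W (fun=> t') w i =
      \sum_(l < i.2 * 2 ^ (M - i.1)) grid_increments h t' w l.
    move=> iJ; rewrite -(big_mkord xpredT (grid_increments h t' w)).
    rewrite telescope_sumr// mul0r addr0 /shifted_path; congr (W (_ + _) w - _).
    rewrite (@dyadic_refine _ i.1 M); last exact: leq_bigmax_seq.
    by rewrite /h /dyadic mul1r.
  apply/seteqP; split => w /= Dw i iJ; have := Dw i iJ; by rewrite E.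
by rewrite !DE; exact: grid_increments_law.
Qed.

End brownian_restart.

(** * Independence of the next block from the past of an arrival *)

Section strong_markov.
Context {R : realType} {disp : measure_display} {Om : measurableType disp}.
Variable P : probability Om R.
Variables (W : R -> Om -> R) (N : R -> Om -> nat) (T : nat -> Om -> R).
Hypothesis W_brownian : standard_brownian_motion P W.
Hypothesis N_renewal : renewal_process P N T.
Hypothesis W_N_independent : independent_processes P W N.

Let W_measurable := bm_measurable W_brownian.
Let N_measurable := renewal_measurable N_renewal.
Let T0 := renewal_start N_renewal.
Let T_increasing := renewal_increasing N_renewal.
Let T_count := renewal_count N_renewal.
Let T_ge0 := arrival_ge0 T0 T_increasing.

Let sigmaW := process_sigma_algebra W [set t | 0 <= t].
Let sigmaN := process_sigma_algebra N [set t | 0 <= t].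

Let sigmaW_sigma : sigma_algebra setT sigmaW := smallest_sigma_algebra _ _.
Let sigmaN_sigma : sigma_algebra setT sigmaN := smallest_sigma_algebra _ _.

Let sigmaW_measurable : sigmaW `<=` measurable.
Proof. exact: (brownian_sigma_measurable W_brownian). Qed.

Let sigmaN_measurable : sigmaN `<=` measurable.
Proof. by apply: process_sigma_algebra_measurable => t; exact: N_measurable. Qed.

Let arrival_sigmaN k : measurable_fun setT (T k : g_sigma_algebraType sigmaN -> R).
Proof.
apply: (measurability _ (RGenOInfty.measurableE R)) => _ [_ [a ->] <-].
rewrite setTI (measurable_g_measurableTypeE sigmaN_sigma).
rewrite (_ : _ @^-1` _ = ~` [set w | T k w <= a]); last first.
  by apply/seteqP; split => w /=; rewrite in_itv/= andbT ltNge => /negP.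
apply: (sigma_algebra_setC sigmaN_sigma).
have [a0|a0] := ltP a 0.
  rewrite (_ : [set _ | _] = set0); first by case: sigmaN_sigma.
  by apply/seteqP; split => w //= Ta; have := le_lt_trans Ta a0; rewrite ltNge T_ge0.
rewrite (_ : [set _ | _] = N a @^-1` [set n | (k <= n)%N]).
  apply: sub_sigma_algebra; exists a => //.
  by exists [set n | (k <= n)%N]; rewrite ?setTI.
by apply/seteqP; split => w /=; rewrite T_count.
Qed.

Lemma measurable_arrival_time k : measurable_fun setT (T k).
Proof. exact: (measurable_fun_of_sub sigmaN_sigma sigmaN_measurable). Qed.

Let gap k w := T k.+1 w - T k w.

Let gap_mem k (I : set R) : measurable I -> sigmaN (gap k @^-1` I).
Proof.
move=> mI.
have m : measurable_fun setT (gap k : g_sigma_algebraType sigmaN -> R).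
  exact: measurable_funB.
by have := m measurableT I mI; rewrite setTI (measurable_g_measurableTypeE sigmaN_sigma).
Qed.

Let measurable_gap k : measurable_fun setT (gap k).
Proof. by apply: measurable_funB; exact: measurable_arrival_time. Qed.

Let dyadic_index_mem k n j : sigmaN [set w | dyadic_index n (T k w) = j].
Proof.
have := arrival_sigmaN k measurableT (measurable_dyadic_index (R := R) n j).
by rewrite setTI (measurable_g_measurableTypeE sigmaN_sigma).
Qed.

Let path_mem t (C : set (path_space R (nat * nat)%type)) : 0 <= t ->
  measurable C -> sigmaW (shifted_path W (fun=> t) @^-1` C).
Proof.
move=> t0 mC.
pose G := \bigcup_(t in [set t | 0 <= t]) preimage_set_system setT (W t) measurable.
have h s : 0 <= s -> measurable_fun setT (W s : g_sigma_algebraType G -> R).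
  by move=> s0; apply: (@measurable_process _ _ _ _ _ W [set t | 0 <= t] G s).
have m : measurable_fun setT
    (shifted_path W (fun=> t) : g_sigma_algebraType G -> _).
  apply: measurable_to_path => i; apply: measurable_funB; apply: h => //.
  by rewrite addr_ge0// dyadic_ge0.
by have := m measurableT C mC; rewrite setTI.
Qed.

(** All of [N] is included because the gap after [T k], which lies in the future, must stay on this
    side when the path is split off. Independence of [W] and [N] makes the enlargement harmless for
    the increments of [W] after t. *)
Let mixed_past t : set (set Om) := <<s [set A | exists A1 A2,
  [/\ process_sigma_algebra W `[0, t] A1, sigmaN A2 & A = A1 `&` A2]] >>.

Let past_sub t : process_sigma_algebra W `[0, t] `<=` sigmaW.
Proof.
by apply: process_sigma_algebra_mono => x /=; rewrite in_itv => /andP[].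
Qed.

Let sigmaT G : sigma_algebra setT G -> G (setT : set Om).
Proof. by move=> sG; rewrite -setC0; apply: (sigma_algebra_setC sG); case: sG. Qed.

Let sigmaN_mixed t : sigmaN `<=` mixed_past t.
Proof.
move=> A NA; apply: sub_sigma_algebra; exists setT, A; split; rewrite ?setTI//.
exact: sigmaT (smallest_sigma_algebra _ _).
Qed.

Let joint_past_mixed t : joint_past W N t `<=` mixed_past t.
Proof.
apply: smallest_sub; first exact: smallest_sigma_algebra.
move=> _ [u [/andP[u0 ut] [[C mC ->]|[C ->]]]].
  apply: sub_sigma_algebra; exists (W u @^-1` C), setT; split; rewrite ?setIT//.
    apply: sub_sigma_algebra; exists u; first by rewrite /= in_itv/= u0.
    by exists C; rewrite ?setTI.
  exact: sigmaT.
apply: sigmaN_mixed; apply: sub_sigma_algebra; exists u => //.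
by exists C; rewrite ?setTI.
Qed.

Let mixed_past_measurable t : mixed_past t `<=` measurable.
Proof.
apply: smallest_sub; first exact: sigma_algebra_measurable.
move=> _ [A1 [A2 [FA1 NA2 ->]]]; apply: measurableI.
  by apply: sigmaW_measurable; exact: past_sub FA1.
exact: sigmaN_measurable.
Qed.

Let mixed_restart t A C : 0 <= t -> mixed_past t A -> measurable C ->
  (P (A `&` shifted_path W (fun=> t) @^-1` C) =
   P A * P (shifted_path W (fun=> 0%R) @^-1` C))%E.
Proof.
move=> t0 FA mC.
have mV u : 0 <= u -> measurable (shifted_path W (fun=> u) @^-1` C).
  by move=> u0; exact: measurable_preim (measurable_shifted_path W_brownian u0) mC.
have fT : process_sigma_algebra W `[0, t] setT.
  exact: sigmaT (smallest_sigma_algebra _ _).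
have -> : P (shifted_path W (fun=> 0%R) @^-1` C) =
    P (shifted_path W (fun=> t) @^-1` C).
  have := brownian_restart W_brownian t0 fT mC.
  by rewrite setTI probability_setT mul1e.
move: A FA; apply: independent_dynkin.
- exact: mV.
- move=> _ _ [A1 [A2 [FA1 NA2 ->]]] [B1 [B2 [FB1 NB2 ->]]].
  exists (A1 `&` B1), (A2 `&` B2); split; last by rewrite setIACA.
    exact: (sigma_algebra_setI (smallest_sigma_algebra _ _)).
  exact: (sigma_algebra_setI sigmaN_sigma).
- by move=> A FA; apply: (@mixed_past_measurable t); exact: sub_sigma_algebra.
- move=> _ [A1 [A2 [FA1 NA2 ->]]].
  have WA1 := past_sub FA1.
  rewrite setIAC W_N_independent//; last first.
    by apply: (sigma_algebra_setI sigmaW_sigma) => //; exact: path_mem.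
  rewrite (brownian_restart W_brownian t0 FA1 mC) (W_N_independent WA1 NA2).
  have := brownian_restart W_brownian t0 fT mC.
  rewrite setTI probability_setT mul1e => ->.
  by rewrite muleAC.
Qed.

Let arrival_slice k n j A : arrival_sigma W N T k A ->
  joint_past W N (dyadic n (j + 2)) (A `&` [set w | T k w <= dyadic n (j + 1)]).
Proof.
move=> SA; apply: (@joint_filtration_sub_past _ _ _ _ _ W_measurable N_measurable
  (dyadic n (j + 1))).
- exact: dyadic_ge0.
- by rewrite /dyadic ltr_pM2r ?invr_gt0 ?exprn_gt0// ltr_nat ltn_add2l.
- by apply: SA; exact: dyadic_ge0.
Qed.

Let arrival_dyadic_le k n w : T k w <= dyadic n (dyadic_index n (T k w) + 1).
Proof. by rewrite addn1 ltW// dyadic_index_gt. Qed.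


(* The dyadic time is taken two steps above [T k]: one step to be at least
   [T k], and one more because [joint_filtration] is right-continuous. *)
Let V_ k n := shifted_path W (fun w => dyadic n (dyadic_index n (T k w) + 2)).

Let mV_ k n : measurable_fun setT (V_ k n).
Proof.
apply: (@measurable_countable_glue _ _ _ _ (fun w => dyadic_index n (T k w))
  (fun j => shifted_path W (fun=> dyadic n (j + 2)))) => j.
  by apply: sigmaN_measurable; exact: dyadic_index_mem.
by apply: (measurable_shifted_path W_brownian); exact: dyadic_ge0.
Qed.

Let cV k w i : V_ k n w i @[n --> \oo] --> shifted_path W (T k) w i.
Proof.
have cW : continuous (fun t : R => W (Num.max 0 t) w).
  exact: (continuous_positive_part (bm_continuous W_brownian (w := w))).
have h := @cvg_dyadic_index R 2 _ (T_ge0 k w).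
have h' : dyadic n (dyadic_index n (T k w) + 2) + dyadic i.1 i.2 @[n --> \oo] -->
    T k w + dyadic i.1 i.2 by apply: cvgD; [exact: h|exact: cvg_cst].
have := cvgB (cvg_comp _ _ h' (cW _)) (cvg_comp _ _ h (cW _)).
rewrite /= !max_r ?addr_ge0 ?dyadic_ge0 ?T_ge0// => /(_ eventually_filter) h3.
rewrite /V_ /shifted_path; apply: cvg_trans h3; apply: near_eq_cvg; near=> n => /=.
by rewrite !fctE /= !max_r ?addr_ge0 ?dyadic_ge0.
Unshelve. all: by end_near. Qed.

Lemma measurable_shifted_arrival k : measurable_fun setT (shifted_path W (T k)).
Proof.
apply: measurable_to_path => i.
apply: (@measurable_fun_cvg _ _ _ _ (fun n w => V_ k n w i)) => // n.
exact: (measurableT_comp (measurable_path_eval i) (mV_ k n)).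
Qed.

(** For the dyadic approximations of [T k] the event is cut into slices on which the restart time is
    a constant, and [mixed_restart] is summed over the slices. Continuity of the path carries the
    identity over to [T k]. *)
Lemma brownian_restart_at_arrival k A I C :
  arrival_sigma W N T k A -> measurable I -> measurable C ->
  (P (A `&` gap k @^-1` I `&` shifted_path W (T k) @^-1` C) =
   P (A `&` gap k @^-1` I) * P (shifted_path W (fun=> 0%R) @^-1` C))%E.
Proof.
move=> SA mI mC.
have mA' : measurable (A `&` gap k @^-1` I).
  apply: measurableI; last exact: sigmaN_measurable (gap_mem _ mI).
  exact: (arrival_sigma_measurable W_measurable N_measurable SA).
move: C mC; apply: (factorization_limit mA' (mV_ k)
  (measurable_shifted_arrival k)) => // [|n C mC].
  exact: (measurable_shifted_path W_brownian).
pose F j := A `&` gap k @^-1` I `&` [set w | dyadic_index n (T k w) = j].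
have FE : A `&` gap k @^-1` I = \bigcup_j F j.
  rewrite /F -setI_bigcupr; apply/seteqP; split => w /=; last by move=> [].
  by move=> Aw; split => //; exists (dyadic_index n (T k w)).
have FM j : mixed_past (dyadic n (j + 2)) (F j).
  have -> : F j = (A `&` [set w | T k w <= dyadic n (j + 1)]) `&`
      (gap k @^-1` I `&` [set w | dyadic_index n (T k w) = j]).
    apply/seteqP; split => w /=; last by move=> [[Aw _] [gw nw]].
    by move=> [[Aw gw] <-]; split; split.
  apply: (sigma_algebra_setI (smallest_sigma_algebra _ _)).
    by apply: joint_past_mixed; exact: arrival_slice.
  apply: sigmaN_mixed; apply: (sigma_algebra_setI sigmaN_sigma); first exact: gap_mem.
  exact: dyadic_index_mem.
have tF : trivIset setT F.
  apply/trivIsetP => i j _ _ /eqP ij; apply/seteqP; split => w //= [[_ h1] [_ h2]].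
  by apply: ij; rewrite -h1 -h2.
rewrite {1}FE setI_bigcupl measure_bigcup//=; first last.
- by apply: trivIset_setIr.
- move=> j _; apply: measurableI; first exact: mixed_past_measurable (FM j).
  exact: measurable_preim (mV_ k n) mC.
rewrite [in RHS]FE measure_bigcup//=; last first.
  by move=> j _; exact: mixed_past_measurable (FM j).
rewrite muleC -(fineK (fin_num_prob P _)); last first.
  by apply: (measurable_preim _ mC); exact: (measurable_shifted_path W_brownian).
rewrite -nneseriesZl//; apply: eq_eseriesr => j _.
rewrite fineK; last first.
  apply: fin_num_prob.
  by apply: (measurable_preim _ mC); exact: (measurable_shifted_path W_brownian).
rewrite muleC -(mixed_restart (dyadic_ge0 n (j + 2)) (FM j) mC); congr (P _).
apply/seteqP; split => w /= [Fw]; rewrite /V_ /shifted_path.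
  by have [_ /= ->] := Fw.
by have [_ /= e] := Fw; rewrite e.
Unshelve. all: by end_near. Qed.

Let gaps_sets k : set (set Om) := [set A | exists (J : seq nat) (C : nat -> set R),
  [/\ forall i, i \in J -> (i < k)%N, forall i, measurable (C i) &
      A = [set w | forall i, i \in J -> C i (gap i w)]]].

Let sigma_gaps k : set (set Om) := <<s gaps_sets k >>.

Let gaps_sets_sigmaN k : gaps_sets k `<=` sigmaN.
Proof.
move=> _ [J [C [_ mC ->]]].
pose E := g_sigma_algebraType sigmaN.
suff : @measurable _ E (\bigcap_(i in [set` J]) gap i @^-1` C i).
  by rewrite (measurable_g_measurableTypeE sigmaN_sigma).
apply: (@fin_bigcap_measurable _ E) => [|i _]; first exact: finite_seq.
by rewrite (measurable_g_measurableTypeE sigmaN_sigma); exact: gap_mem.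
Qed.

Let sigma_gaps_sigmaN k : sigma_gaps k `<=` sigmaN.
Proof. by apply: smallest_sub => //; exact: gaps_sets_sigmaN. Qed.

(** Mutual independence is used twice, for the indices of [J] without repetition and for these
    together with [k]; the two products differ by the factor of gap k. *)
Let gaps_independent k A I : sigma_gaps k A -> measurable I ->
  (P (A `&` gap k @^-1` I) = P A * P (gap k @^-1` I))%E.
Proof.
move=> GA mI; move: A GA; apply: independent_dynkin.
- exact: measurable_preim.
- move=> _ _ [J1 [C1 [J1k mC1 ->]]] [J2 [C2 [J2k mC2 ->]]].
  exists (J1 ++ J2), (fun i => (if i \in J1 then C1 i else setT) `&`
    (if i \in J2 then C2 i else setT)); split.
  + by move=> i; rewrite mem_cat => /orP[/J1k|/J2k].
  + by move=> i; apply: measurableI; case: ifP.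
  + apply/seteqP; split => w /=.
      move=> [h1 h2] i _; split; case: ifPn => // iJ; [exact: h1|exact: h2].
    move=> h; split => i iJ; have := h i; rewrite mem_cat iJ ?orbT => /(_ isT)[//].
- by move=> A /gaps_sets_sigmaN; exact: sigmaN_measurable.
- move=> _ [J [C [Jk mC ->]]].
  pose C' i := if i == k then I else C i.
  have mC' i : measurable (C' i) by rewrite /C'; case: ifP.
  have kJ : k \notin undup J.
    by rewrite mem_undup; apply/negP => /Jk; rewrite ltnn.
  have C'E i : i \in undup J -> C' i = C i.
    by rewrite /C'; case: eqP => // -> kin; rewrite kin in kJ.
  have h1 := renewal_independent N_renewal (J := undup J) (A := C')
    (undup_uniq _) (fun i _ => mC' i).
  have u : uniq (k :: undup J) by rewrite /= kJ undup_uniq.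
  have h2 := renewal_independent N_renewal (A := C') u (fun i _ => mC' i).
  rewrite big_cons -h1 /C' eqxx muleC in h2.
  have E0 : \bigcap_(i in [set` undup J]) (gap i @^-1` C' i) =
      [set w | forall i, i \in J -> C i (gap i w)].
    apply/seteqP; split => w /= h i iJ.
      by have := h i; rewrite /= mem_undup => /(_ iJ); rewrite C'E// mem_undup.
    by move: (iJ); rewrite /= => iJ'; rewrite C'E//; apply: h; rewrite -mem_undup.
  rewrite -E0; rewrite -[RHS]h2; congr (P _).
  apply/seteqP; split => w /=.
    move=> [h Iw] i; rewrite /= inE => /predU1P[->|iJ]; first by rewrite eqxx.
    exact: h.
  move=> h; split; last by have := h k; rewrite /= inE eqxx; exact.
  by move=> i iJ; apply: h; rewrite /= inE iJ orbT.
Qed.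

(** Counterpart of [mixed_past]: here the whole of [W] is included and [N] enters only through the
    gaps before [T k], so that gap k is independent of it. *)
Let history k : set (set Om) := <<s [set A | exists A1 A2,
  [/\ sigma_gaps k A1, sigmaW A2 & A = A1 `&` A2]] >>.

Let history_sigma k : sigma_algebra setT (history k) := smallest_sigma_algebra _ _.

Let history_measurable k : history k `<=` measurable.
Proof.
apply: smallest_sub; first exact: sigma_algebra_measurable.
move=> _ [A1 [A2 [GA1 WA2 ->]]].
have mA1 := sigmaN_measurable (sigma_gaps_sigmaN GA1).
have mA2 := sigmaW_measurable WA2.
exact: measurableI.
Qed.

Let history_independent k A I : history k A -> measurable I ->
  (P (A `&` gap k @^-1` I) = P A * P (gap k @^-1` I))%E.
Proof.
move=> HA mI; move: A HA; apply: independent_dynkin.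
- exact: measurable_preim.
- move=> _ _ [A1 [A2 [FA1 NA2 ->]]] [B1 [B2 [FB1 NB2 ->]]].
  exists (A1 `&` B1), (A2 `&` B2); split; last by rewrite setIACA.
    exact: (sigma_algebra_setI (smallest_sigma_algebra _ _)).
  exact: (sigma_algebra_setI sigmaW_sigma).
- by move=> A GA; apply: (@history_measurable k); exact: sub_sigma_algebra.
- move=> _ [A1 [A2 [GA1 WA2 ->]]].
  rewrite setIAC setIC W_N_independent//; last first.
    apply: (sigma_algebra_setI sigmaN_sigma); last exact: gap_mem.
    exact: sigma_gaps_sigmaN GA1.
  rewrite gaps_independent// setIC W_N_independent//; last first.
    exact: sigma_gaps_sigmaN GA1.
  by rewrite muleA.
Qed.

Let arrival_history k i : (i <= k)%N ->
  measurable_fun setT (T i : g_sigma_algebraType (history k) -> R).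
Proof.
move=> ik.
have mg l : (l < k)%N ->
    measurable_fun setT (gap l : g_sigma_algebraType (history k) -> R).
  move=> lk _ C mC; rewrite setTI (measurable_g_measurableTypeE (history_sigma k)).
  apply: sub_sigma_algebra.
  exists (gap l @^-1` C), setT; split; rewrite ?setIT//; last exact: sigmaT.
  apply: sub_sigma_algebra; exists [:: l], (fun=> C); split => //.
    by move=> j; rewrite inE => /eqP ->.
  apply/seteqP; split => w /=; first by move=> Cw j; rewrite inE => /eqP ->.
  by apply; rewrite mem_head.
elim: i ik => [|i IH] ik.
  by rewrite (_ : T 0%N = cst 0)//; apply/funext => w; exact: T0.
rewrite (_ : T i.+1 = fun w => T i w + gap i w).
  by apply: measurable_funD; [exact: IH (ltnW ik)|exact: mg].
by apply/funext => w; rewrite /gap addrC subrK.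
Qed.

Let arrival_le_history k i u : (i <= k)%N -> history k [set w | T i w <= u].
Proof.
move=> ik; have := arrival_history ik measurableT (measurable_itv `]-oo, u]).
rewrite setTI (measurable_g_measurableTypeE (history_sigma k)).
by congr (history k _); apply/seteqP; split => w /=; rewrite in_itv.
Qed.

(** On the event [N s = k] no count before s exceeds k. So [N u = n] can be read from the first k
    arrivals: for n < k from [T n] and [T n.+1], and for n = k from [T k] alone, the bound
    [u < T k.+1] being automatic. *)
Let joint_past_trace k s A : 0 <= s -> joint_past W N s A ->
  exists2 A', history k A' &
    A `&` [set w | N s w = k] = A' `&` [set w | N s w = k].
Proof.
move=> s0; have sH := history_sigma k; move: A.
apply: smallest_sub.
  split.
  - by exists set0; [case: sH|].
  - move=> A [A' HA' AE]; exists (~` A'); first exact: (sigma_algebra_setC sH).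
    rewrite setTD; apply/seteqP; split => w /= [nA Nw]; split => // Aw; apply: nA.
      by have [_ /(_ w (conj Aw Nw))[]] := (seteqP _ _).1 AE.
    by have [/(_ w (conj Aw Nw))[]] := (seteqP _ _).1 AE.
  - move=> F FP.
    have /choice[F' F'P] : forall n, exists A', history k A' /\
        F n `&` [set w | N s w = k] = A' `&` [set w | N s w = k].
      by move=> n; have [A' HA' AE] := FP n; exists A'.
    exists (\bigcup_n F' n).
      by have [_ _] := sH; apply => n; have [] := F'P n.
    by rewrite !setI_bigcupl; apply: eq_bigcupr => n _; have [] := F'P n.
move=> _ [u [/andP[u0 us] [[C mC ->]|[C ->]]]].
  exists (W u @^-1` C) => //; apply: sub_sigma_algebra.
  exists setT, (W u @^-1` C); split; rewrite ?setTI//.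
    exact: sigmaT (smallest_sigma_algebra _ _).
  by apply: sub_sigma_algebra; exists u => //; exists C; rewrite ?setTI.
have Nuk w : N s w = k -> (N u w <= k)%N.
  by move=> <-; rewrite -T_count//; apply: le_trans us; rewrite T_count.
pose D n := if (n < k)%N then [set w | T n w <= u] `&` ~` [set w | T n.+1 w <= u]
  else if n == k then [set w | T n w <= u] else set0.
exists (\bigcup_n (if `[< C n >] then D n else set0)).
  have [H0 _ HU] := sH; apply: HU => n; case: ifP => // _.
  rewrite /D; case: ltnP => nk.
    apply: (sigma_algebra_setI sH); first exact: arrival_le_history (ltnW nk).
    by apply: (sigma_algebra_setC sH); exact: arrival_le_history.
  by case: eqP => // ->; exact: arrival_le_history.
apply/seteqP; split => w /= [Cw Nk]; split => //.
  exists (N u w) => //; case: asboolP => // _; rewrite /D.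
  move: (Nuk w Nk); rewrite leq_eqVlt => /predU1P[e|->].
    by rewrite e ltnn eqxx /= T_count// e.
  by split => /=; rewrite T_count ?leqnn// ltnn.
case: Cw => n _; case: asboolP => // Cn; rewrite /D; case: ltnP => nk.
  rewrite /= !T_count// => -[h1 /negP]; rewrite -ltnNge ltnS => h2.
  by have -> : N u w = n by apply/eqP; rewrite eqn_leq h1 h2.
case: eqP => // nE /=; rewrite T_count// => h1.
by have -> : N u w = n by apply/eqP; rewrite eqn_leq h1 andbT nE Nuk.
Qed.

(* A dyadic time slightly above [T k] eventually lies before [T k.+1], where the
   past is described by [history k]; so [A] is a lower limit of sets of it. *)
Lemma arrival_sigma_history k : arrival_sigma W N T k `<=` history k.
Proof.
move=> A SA; have sH := history_sigma k.
have /choice[A' A'P] : forall nj : nat * nat, exists A', history k A' /\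
    A `&` [set w | T k w <= dyadic nj.1 (nj.2 + 1)] `&`
      [set w | N (dyadic nj.1 (nj.2 + 2)) w = k] =
    A' `&` [set w | N (dyadic nj.1 (nj.2 + 2)) w = k].
  move=> [n j]; have [A' HA' AE] := @joint_past_trace k _ _ (dyadic_ge0 _ _)
    (@arrival_slice k n j A SA).
  by exists A'.
pose F n := \bigcup_j (A' (n, j) `&` [set w | dyadic_index n (T k w) = j]).
have HF n : history k (F n).
  rewrite /F; have [_ _ HU] := sH; apply: HU => j; apply: (sigma_algebra_setI sH).
    by have [] := A'P (n, j).
  have := arrival_history (leqnn k) measurableT (measurable_dyadic_index (R := R) n j).
  by rewrite setTI (measurable_g_measurableTypeE sH).
have FA w : \forall n \near \oo, F n w <-> A w.
  have h := @cvg_dyadic_index R 2 _ (T_ge0 k w).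
  have : \forall n \near \oo, dyadic n (dyadic_index n (T k w) + 2) < T k.+1 w.
    by apply: (cvgr_lt _ h); exact: T_increasing.
  apply: filterS => n nT.
  set j := dyadic_index n (T k w).
  have Nk : N (dyadic n (j + 2)) w = k.
    apply: (count_between T0 T_increasing T_count); rewrite nT andbT.
    apply: (le_trans (arrival_dyadic_le k n w)).
    by rewrite /dyadic ler_wpM2r ?invr_ge0 ?exprn_ge0// ler_nat leq_add2l.
  have [_ /= AE] := A'P (n, j); split.
    move=> [j' _ [A'w /= jE]]; rewrite -jE -/j in A'w.
    have [_ /(_ w (conj A'w Nk))[[]]] := (seteqP _ _).1 AE.
    by [].
  move=> Aw; exists j => //; split => //.
  have [/(_ w (conj (conj Aw (arrival_dyadic_le k n w)) Nk))[]] := (seteqP _ _).1 AE.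
  by [].
have -> : A = \bigcup_m \bigcap_(n in [set n | (m <= n)%N]) F n.
  apply/seteqP; split => w /=.
    by move=> Aw; have [m _ h] := FA w; exists m => // n /= mn; apply/(h n mn).
  move=> [m _ h]; have [m' _ h'] := FA w.
  by apply/(h' (maxn m m')); [exact: leq_maxr|apply: h; exact: leq_maxl].
have HE := measurable_g_measurableTypeE sH.
rewrite -HE; apply: (@bigcupT_measurable _ (g_sigma_algebraType (history k))) => m.
apply: (@bigcap_measurableType _ (g_sigma_algebraType (history k))) => n _.
by rewrite HE.
Qed.

Let gap0_law k A I : arrival_sigma W N T k A -> measurable I ->
  (P (A `&` gap k @^-1` I) = P A * P (gap 0 @^-1` I))%E.
Proof.
move=> /arrival_sigma_history HA mI; rewrite history_independent//.
by rewrite (renewal_identically_distributed N_renewal k 0%N mI).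
Qed.

Definition renewal_block k (w : Om) : R * path_space R (nat * nat)%type :=
  (T k.+1 w - T k w, shifted_path W (T k) w).

Lemma measurable_renewal_block k : measurable_fun setT (renewal_block k).
Proof.
apply: measurable_fun_pair; first exact: measurable_gap.
exact: measurable_shifted_arrival.
Qed.

(** The path is split off first, with the gap still on the side of the past; then the gap is split
    off. The two remaining factors recombine into the law of the first block, since [W] and [N] are
    independent. *)
Lemma strong_markov k A C : arrival_sigma W N T k A -> measurable C ->
  (P (A `&` renewal_block k @^-1` C) = P A * P (renewal_block 0 @^-1` C))%E.
Proof.
move=> SA mC.
have mA := arrival_sigma_measurable W_measurable N_measurable SA.
have E0 : shifted_path W (T 0%N) = shifted_path W (fun=> 0).
  by apply/funext => w; rewrite /shifted_path T0.
apply: (factorization_dynkin mA (measurable_renewal_block k)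
  (measurable_renewal_block 0%N) (measurable_prod_measurableType _ _)) mC.
  move=> _ _ [A1 mA1 [B1 mB1 <-]] [A2 mA2 [B2 mB2 <-]].
  exists (A1 `&` A2); first exact: measurableI.
  exists (B1 `&` B2); first exact: measurableI.
  by rewrite setXI.
move=> _ [I mI [D mD <-]].
have E k' : renewal_block k' @^-1` (I `*` D) =
    gap k' @^-1` I `&` shifted_path W (T k') @^-1` D by [].
rewrite !E setIA brownian_restart_at_arrival// gap0_law// E0 -muleA; congr (_ * _)%E.
rewrite setIC W_N_independent 1?muleC//; first exact: path_mem.
exact: gap_mem.
Qed.

(** The first argument of [f] is the sample point itself under the past sigma-algebra, so [f] may
    contain any adapted quantity; such quantities are frozen in the inner integral. *)
Lemma integral_strong_markov k
    (f : g_sigma_algebraType (arrival_sigma W N T k) *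
         (R * path_space R (nat * nat)%type) -> \bar R) :
  measurable_fun setT f -> (forall x, 0 <= f x)%E ->
  (\int[P]_w f (w, renewal_block k w) =
   \int[P]_w \int[P]_w' f (w, renewal_block 0 w'))%E.
Proof.
move=> mf f0.
have SE := measurable_arrival_sigmaE W T_count k.
have mS := arrival_sigma_measurable W_measurable N_measurable.
apply: (@integral_factorization _ _ _ P _ _
  (g_sigma_algebraType (arrival_sigma W N T k)) _ id
  (renewal_block k) (renewal_block 0) f) => //.
- by move=> _ A; rewrite SE setTI => /mS.
- exact: measurable_renewal_block.
- exact: measurable_renewal_block.
- by move=> A C; rewrite SE => SA mC; rewrite strong_markov.
Qed.

End strong_markov.

(** Monotonicity makes the preimages of the generating intervals intervals again. *)
Lemma nondecreasing_emeasurable (R : realType) (u : R -> \bar R) :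
  {homo u : x y / x <= y >-> (x <= y)%E} -> measurable_fun setT u.
Proof.
move=> u_nd; apply: (measurability _ (ErealGenCInfty.measurableE R)).
move=> _ [_ [r ->] <-]; rewrite setTI; apply: is_interval_measurable => s t /=.
rewrite !in_itv/= => /andP[rs _] /andP[_ ty] x /andP[sx xt].
by rewrite in_itv/= (le_trans rs) ?u_nd//= (le_lt_trans _ ty)// u_nd.
Qed.

(** A set closed downwards either has a greatest element, which is listed, or has a rational
    strictly between any member and some larger member. *)
Lemma countable_cofinal (R : realType) (D : nat -> set R) :
  (forall n x y, D n y -> x <= y -> D n x) ->
  exists c : nat -> R, forall n z, D n z -> exists2 i, D n (c i) & z <= c i.
Proof.
move=> Ddown.
pose top n := xget 0 [set x | D n x /\ forall y, D n y -> y <= x].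
(* Odd indices list the greatest elements, with default 0 where there is none; even indices
   enumerate the rationals. *)
pose c i := if odd i then top i./2 else
  if unpickle i./2 is Some q then ratr q else 0.
exists c => n z Dz.
have [[x [Dx xmax]]|nmax] := pselect (exists x, D n x /\ forall y, D n y -> y <= x).
  have [Dt tmax] : D n (top n) /\ forall y, D n y -> y <= top n.
    by rewrite /top; case: xgetP => [y _ //|/(_ x)]; case.
  exists n.*2.+1; rewrite /c/= odd_double/= uphalf_double//.
  exact: tmax.
have [y Dy zy] : exists2 y, D n y & z < y.
  apply: contra_notP nmax => h; exists z; split => // y Dy.
  by rewrite leNgt; apply/negP => zy; apply: h; exists y.
have [q /andP[/= zq qy]] := rat_in_itvoo zy.
exists (pickle q).*2; rewrite /c odd_double doubleK pickleK.
  exact: Ddown Dy (ltW qy).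
exact: ltW.
Qed.

(** * Finite horizon values of a monotone control problem *)

Section monotone_control.
Context {R : realType} {disp : measure_display} {Om : measurableType disp}.
Variables (P : probability Om R) (D : R -> R -> Om -> R) (q : Om -> R) (d : R).
Hypothesis D_measurable :
  measurable_fun setT (fun x : R * R * Om => D x.1.1 x.1.2 x.2).
Hypothesis D_mono : forall b w, {homo (fun z => D z b w) : x y / x <= y}.
Hypothesis q_measurable : measurable_fun setT q.
Hypothesis q01 : forall w, 0 < q w < 1.
Implicit Type u : R -> \bar R.

Local Open Scope ereal_scope.

Definition discounted u (z b : R) : \bar R := \int[P]_w ((q w)%:E * u (D z b w)).

Definition bellman u (z : R) : \bar R :=
  (d < z)%R%:R%:E + ereal_inf [set discounted u z b | b in `[0%R, 1%R]].

Definition horizon_value (n : nat) : R -> \bar R := iter n bellman (cst 0).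

Definition mean_discount : \bar R := \int[P]_w (q w)%:E.

Let q_ge0 w : (0 <= q w)%R. Proof. by have /andP[/ltW] := q01 w. Qed.

Let measurable_q : measurable_fun setT (fun w => (q w)%:E).
Proof. exact/measurable_EFinP. Qed.

Let measurable_D z b : measurable_fun setT (D z b).
Proof.
have m : measurable_fun setT (fun w : Om => ((z, b), w)).
  by apply: measurable_fun_pair => //; exact: measurable_cst.
exact: (measurableT_comp D_measurable m).
Qed.

Let measurable_integrand u z b : measurable_fun setT u ->
  measurable_fun setT (fun w => (q w)%:E * u (D z b w)).
Proof.
by move=> mu; apply: emeasurable_funM => //; exact: measurableT_comp.
Qed.

Lemma integral_cst_prob (c : \bar R) : \int[P]_w c = c.
Proof.
transitivity (c * P setT); first exact: integral_cst.
by rewrite probability_setT mule1.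
Qed.

Lemma discounted_ge0 u z b : (forall x, 0 <= u x) -> 0 <= discounted u z b.
Proof. by move=> u0; apply: integral_ge0 => w _; rewrite mule_ge0 ?lee_fin. Qed.

Lemma le_discounted u1 u2 z1 z2 b : measurable_fun setT u1 ->
  measurable_fun setT u2 -> (forall x, 0 <= u1 x) ->
  (forall w, u1 (D z1 b w) <= u2 (D z2 b w)) ->
  discounted u1 z1 b <= discounted u2 z2 b.
Proof.
move=> m1 m2 u0 u12; apply: ge0_le_integral => //.
- by move=> w _; rewrite mule_ge0 ?lee_fin.
- exact: measurable_integrand.
- exact: measurable_integrand.
- by move=> w _; rewrite lee_wpmul2l ?lee_fin.
Qed.

Lemma discountedD u z b (c : \bar R) : measurable_fun setT u ->
  (forall x, 0 <= u x) -> 0 <= c ->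
  discounted (fun x => u x + c) z b = discounted u z b + c * mean_discount.
Proof.
move=> mu u0 c0; rewrite /discounted.
under eq_integral do rewrite ge0_muleDr// [X in _ + X]muleC.
rewrite ge0_integralD//.
- by rewrite ge0_integralZl// => w _; rewrite lee_fin.
- by move=> w _; rewrite mule_ge0 ?lee_fin.
- exact: measurable_integrand.
- by move=> w _; rewrite mule_ge0 ?lee_fin.
- by apply: emeasurable_funM => //; exact: measurable_cst.
Qed.

Lemma measurable_discounted u : measurable_fun setT u -> (forall x, 0 <= u x) ->
  measurable_fun setT (fun x : R * R => discounted u x.1 x.2).
Proof.
move=> mu u0.
apply: (@measurable_fun_fubini_tonelli_F _ _ _ _ _ P
  (fun x : R * R * Om => (q x.2)%:E * u (D x.1.1 x.1.2 x.2))).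
  apply: emeasurable_funM; first exact: (measurableT_comp measurable_q).
  exact: (measurableT_comp mu).
by move=> x; rewrite mule_ge0 ?lee_fin.
Qed.

Lemma mean_discount_ge0 : 0 <= mean_discount.
Proof. by apply: integral_ge0 => w _; rewrite lee_fin. Qed.

(** No constant below 1 is assumed to bound [q], since interarrival times may be arbitrarily short.
    The strict inequality holds because [1 - q] is positive everywhere, hence has a nonzero integral
    under a probability. *)
Lemma mean_discount_lt1 : mean_discount < 1.
Proof.
have m1q : measurable_fun setT (fun w => (1 - q w)%:E).
  by apply/measurable_EFinP; exact: measurable_funB.
have q1 w : (0 < 1 - q w)%R by rewrite subr_gt0; have /andP[] := q01 w.
have I1 : \int[P]_w (1 - q w)%:E + mean_discount = 1.
  rewrite -ge0_integralD//; last 2 first.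
  - by move=> w _; rewrite lee_fin ltW.
  - by move=> w _; rewrite lee_fin.
  under eq_integral do rewrite -EFinD subrK.
  by exact: integral_cst_prob.
have I0 : 0 < \int[P]_w (1 - q w)%:E.
  rewrite lt0e integral_ge0 ?andbT => [|w _]; last by rewrite lee_fin ltW.
  apply/eqP => I0.
  have : \int[P]_w `|(1 - q w)%:E| = 0.
    by rewrite -[RHS]I0; apply: eq_integral => w _; rewrite gee0_abs// lee_fin ltW.
  move=> /(ae_eq_integral_abs P measurableT m1q) [A [mA PA0 AE]].
  have AT : A = setT.
    apply/seteqP; split => // w _; apply: AE => /= /(_ Logic.I) [] /eqP.
    by rewrite gt_eqF.
  have := probability_setT P; rewrite -AT => PA1.
  have : (1 : \bar R) = 0 by rewrite -PA1.
  by move=> /eqP; rewrite eqe oner_eq0.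
have g0 := mean_discount_ge0.
have fg : mean_discount \is a fin_num.
  rewrite ge0_fin_numE//; apply: (@le_lt_trans _ _ 1); last exact: ltry.
  by rewrite -I1 leeDr// ltW.
by rewrite -[ltRHS]I1 lteDr.
Qed.

Lemma bellman_ge0 u z : (forall x, 0 <= u x) -> 0 <= bellman u z.
Proof.
move=> u0; rewrite adde_ge0// ?lee_fin//.
by apply: le_ereal_inf_tmp => _ [b _ <-]; exact: discounted_ge0.
Qed.

Lemma bellman_mono u : (forall x, 0 <= u x) ->
  {homo u : x y / (x <= y)%R >-> x <= y} ->
  {homo bellman u : x y / (x <= y)%R >-> x <= y}.
Proof.
move=> u0 u_nd x y xy; apply: leeD.
  rewrite lee_fin ler_nat; case: (ltP d x) => // dx.
  by rewrite (lt_le_trans dx xy).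
apply: le_ereal_inf_tmp => _ [b b01 <-].
apply: (@le_trans _ _ (discounted u x b)).
  by apply: ereal_inf_lbound; exists b.
have mu := nondecreasing_emeasurable u_nd.
by apply: le_discounted => // w; apply: u_nd; exact: D_mono.
Qed.

Lemma horizon_value_ge0 n z : 0 <= horizon_value n z.
Proof.
by elim: n z => [//|n IH] z; exact: bellman_ge0.
Qed.

Lemma horizon_value_mono n :
  {homo horizon_value n : x y / (x <= y)%R >-> x <= y}.
Proof.
elim: n => [//|n IH]; apply: bellman_mono => // x; exact: horizon_value_ge0.
Qed.

Lemma measurable_horizon_value n : measurable_fun setT (horizon_value n).
Proof. by apply: nondecreasing_emeasurable; exact: horizon_value_mono. Qed.

(** Each stage charges at most one and discounts by at most one, so the value is at most n.
    Finiteness is what permits near-minimisers to be chosen. *)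
Lemma horizon_value_fin n z : horizon_value n z \is a fin_num.
Proof.
rewrite ge0_fin_numE ?horizon_value_ge0//.
suff : forall z, horizon_value n z <= n%:R%:E.
  by move=> /(_ z) /le_lt_trans; apply; exact: ltry.
elim: n => [//|n IH] {}z; rewrite /= -natr1 addrC EFinD; apply: leeD.
  by rewrite lee_fin lern1; case: (_ < _)%R.
apply: (@le_trans _ _ (discounted (horizon_value n) z 0%R)).
  by apply: ereal_inf_lbound; exists 0%R => //=; rewrite in_itv/= lexx ler01.
apply: (@le_trans _ _ (\int[P]_w n%:R%:E)).
  apply: ge0_le_integral => //.
  - by move=> w _; rewrite mule_ge0 ?lee_fin ?horizon_value_ge0.
  - by apply: measurable_integrand; exact: measurable_horizon_value.
  - move=> w _; rewrite -[leRHS]mul1e; apply: lee_pmul; rewrite ?lee_fin//.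
    + exact: horizon_value_ge0.
    + by have /andP[_ /ltW] := q01 w.
by rewrite integral_cst_prob.
Qed.

(* By monotonicity an action that is good at [c] is good at every [z <= c] whose
   value is not much smaller, so countably many actions are enough. *)
Lemma measurable_selector u (e : R) : (0 < e)%R -> (forall x, 0 <= u x) ->
  {homo u : x y / (x <= y)%R >-> x <= y} ->
  (forall z, bellman u z \is a fin_num) ->
  exists beta : R -> R, [/\ measurable_fun setT beta,
    forall z, (0 <= beta z <= 1)%R &
    forall z, (d < z)%R%:R%:E + discounted u z (beta z) <= bellman u z + e%:E].
Proof.
move=> e0 u0 u_nd fB.
have mu := nondecreasing_emeasurable u_nd.
pose B z := fine (bellman u z).
have BE z : bellman u z = (B z)%:E by rewrite fineK.
have B_nd x y : (x <= y)%R -> (B x <= B y)%R.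
  by move=> xy; rewrite -lee_fin -!BE bellman_mono.
have B_ge0 z : (0 <= B z)%R by rewrite fine_ge0// bellman_ge0.
have e20 : (0 < e / 2)%R by rewrite divr_gt0.
(* The sublevel sets at multiples of e / 2 are closed downwards. The first multiple above [B z]
   exceeds it by at most e / 2, so some [c i >= z] has a value within e / 2 of [B z]; the other e /
   2 pays for a near-minimiser at [c i]. *)
have [c cP] := @countable_cofinal R (fun n => [set z | (B z < n%:R * (e / 2))%R])
  (fun n x y By xy => le_lt_trans (B_nd _ _ xy) By).
have cex z : exists i, `[< (z <= c i)%R /\ (B (c i) < B z + e / 2)%R >].
  pose n := (Num.truncn (B z / (e / 2))).+1.
  have Bz : (B z < n%:R * (e / 2))%R by rewrite -ltr_pdivrMr// truncnS_gt.
  have [i Bi zi] := cP _ _ Bz.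
  exists i; apply/asboolP; split => //; apply: (lt_le_trans Bi).
  rewrite /n -natr1 mulrDl mul1r lerD2r -ler_pdivlMr//.
  by rewrite truncn_le divr_ge0// ltW.
pose k z := ex_minn (cex z).
have kP z : (z <= c (k z))%R /\ (B (c (k z)) < B z + e / 2)%R.
  by rewrite /k; case: ex_minnP => i /asboolP.
have /choice[b bP] : forall i, exists b, (0 <= b <= 1)%R /\
    (d < c i)%R%:R%:E + discounted u (c i) b <= bellman u (c i) + (e / 2)%:E.
  move=> i.
  have f : ereal_inf [set discounted u (c i) b | b in `[0%R, 1%R]] \is a fin_num.
    have := fB (c i); rewrite /bellman fin_numD => /andP[_].
    by [].
  have [_ [b b01 <-] bi] := lb_ereal_inf_adherent e20 f.
  exists b; split; first by move: b01; rewrite /= in_itv.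
  by rewrite /bellman -addeA leeD2l// ltW.
exists (b \o k); split => [|z|z]; last 2 first.
- by have [] := bP (k z).
- have [zc Bc] := kP z; have [_ h] := bP (k z).
  apply: (@le_trans _ _ ((d < c (k z))%R%:R%:E + discounted u (c (k z)) (b (k z)))).
    apply: leeD.
      rewrite lee_fin ler_nat; case: (ltP d z) => // dz.
      by rewrite (lt_le_trans dz zc).
    by apply: le_discounted => // w; apply: u_nd; exact: D_mono.
  apply: (le_trans h); rewrite !BE -!EFinD lee_fin.
  rewrite (le_trans (lerD (ltW Bc) (lexx _)))// -addrA.
  by rewrite -splitr.
apply: (@measurable_countable_glue _ _ _ _ k (fun i => cst (b i))) => // i.
have mB : measurable_fun setT B by exact: nondecreasing_measurable.
pose S i := [set z | (z <= c i)%R /\ (B (c i) < B z + e / 2)%R].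
have mS j : measurable (S j).
  rewrite (_ : S j = `]-oo, c j] `&` B @^-1` `]B (c j) - e / 2, +oo[)%R.
    apply: measurableI; first exact: measurable_itv.
    by rewrite -[X in measurable X]setTI; apply: mB => //; exact: measurable_itv.
  apply/seteqP; split => z /=; rewrite !in_itv/= andbT ltrBlDr => -[].
    by [].
  by [].
(* Choosing the least admissible index makes its level sets measurable: [S i] without the earlier
   [S j]. *)
rewrite (_ : k @^-1` _ = S i `&` \bigcap_(j in [set j | (j < i)%N]) ~` S j).
  apply: measurableI => //; apply: bigcap_measurableType => j _.
  exact: measurableC.
apply/seteqP; split => z /=.
  rewrite /k; case: ex_minnP => m /asboolP Sm mmin <-; split => // j /= jm Sj.
  by have := mmin j (asboolT Sj); rewrite leqNgt jm.
move=> [Si nS]; rewrite /k; case: ex_minnP => m /asboolP Sm mmin.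
apply/eqP; rewrite eqn_leq mmin ?(asboolT Si)//= leqNgt; apply/negP => mi.
exact: (nS m mi).
Qed.

End monotone_control.

Lemma le_nneseries_partial (R : realType) (f : nat -> \bar R) (c : \bar R) n :
  (forall k, 0 <= f k)%E -> (forall m, \sum_(k < n + m) f k <= c)%E ->
  (\sum_(0 <= k <oo) f k <= c)%E.
Proof.
move=> f0 fc; apply: lime_le; first exact: is_cvg_nneseries.
exists n => // N /= nN; rewrite big_mkord -(subnKC nN); exact: fc.
Qed.

(** * Comparison of the value function with the finite horizon values *)

Section verification.
Context {R : realType} {disp : measure_display} {Om : measurableType disp}.
Variables (P : probability Om R).
Variables (W : R -> Om -> R) (N : R -> Om -> nat) (T : nat -> Om -> R).
Variables (eta theta sigma d r : R).
Hypothesis W_brownian : standard_brownian_motion P W.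
Hypothesis N_renewal : renewal_process P N T.
Hypothesis W_N_independent : independent_processes P W N.
Hypothesis r_gt0 : 0 < r.

Let W_measurable := bm_measurable W_brownian.
Let W_continuous := bm_continuous W_brownian.
Let N_measurable := renewal_measurable N_renewal.
Let T0 := renewal_start N_renewal.
Let T_increasing := renewal_increasing N_renewal.
Let T_count := renewal_count N_renewal.
Let T_ge0 := arrival_ge0 T0 T_increasing.

Let S k := arrival_sigma W N T k.
Let S_sigma k : sigma_algebra setT (S k) := arrival_sigma_algebra W T_count k.
Let S_measurable k : S k `<=` measurable :=
  arrival_sigma_measurable W_measurable N_measurable (k := k).

Let block := renewal_block W T.

(** Expressed by the first block instead of [drawdown], it is jointly measurable and defined for all
    real [z] and [b]; [first_drawdownE] gives the link. *)
Definition first_drawdown (z b : R) (w : Om) : R :=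
  drawdown_map eta theta sigma z b (block 0%N w).1 (block 0%N w).2.

Definition first_discount (w : Om) : R := expR (- r * (block 0%N w).1).

Lemma first_drawdown_measurable :
  measurable_fun setT (fun x : R * R * Om => first_drawdown x.1.1 x.1.2 x.2).
Proof.
have mb := measurable_renewal_block W_brownian N_renewal 0.
apply: measurable_drawdown_map => //.
- exact: (measurableT_comp measurable_fst measurable_fst).
- exact: (measurableT_comp measurable_snd measurable_fst).
- exact: (measurableT_comp measurable_fst (measurableT_comp mb measurable_snd)).
- exact: (measurableT_comp measurable_snd (measurableT_comp mb measurable_snd)).
Qed.

Lemma first_drawdown_mono b w :
  {homo (fun z => first_drawdown z b w) : x y / x <= y}.
Proof.
move=> x y xy; rewrite /first_drawdown /=.
have cWc : continuous (fun t : R => W (Num.max 0 t) w).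
  exact: (continuous_positive_part (W_continuous (w := w))).
pose Y s := drift eta theta b * s +
  volatility sigma b * (W (Num.max 0 (T 0%N w + s)) w - W (T 0%N w) w).
have cY : continuous Y.
  move=> s; apply: cvgD; first by apply: cvgM; [exact: cvg_cst|exact: cvg_id].
  apply: cvgM; first exact: cvg_cst.
  apply: cvgB; last exact: cvg_cst.
  have h : T 0%N w + x @[x --> s] --> T 0%N w + s.
    by apply: cvgD; [exact: cvg_cst|exact: cvg_id].
  exact: (cvg_comp _ _ h (cWc (T 0%N w + s))).
have g0 : 0 <= T 1%N w - T 0%N w by rewrite subr_ge0 ltW.
have E z := @drawdown_mapE _ eta theta sigma z b (T 1%N w - T 0%N w)
  (shifted_path W (T 0%N) w) Y cY g0.
rewrite !E; try by move=> n j _; rewrite /Y /= max_r// addr_ge0 ?dyadic_ge0.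
by rewrite lerD2r ge_max !le_max xy lexx orbT.
Qed.

Lemma measurable_first_discount : measurable_fun setT first_discount.
Proof.
have mb := measurable_renewal_block W_brownian N_renewal 0.
apply: measurableT_comp => //; apply: measurable_funM => //.
exact: (measurableT_comp measurable_fst mb).
Qed.

Lemma first_discount01 w : 0 < first_discount w < 1.
Proof.
rewrite expR_gt0/= -expR0 ltr_expR mulNr oppr_lt0 mulr_gt0//.
by rewrite subr_gt0.
Qed.

Local Notation disc := (discounted P first_drawdown first_discount).
Local Notation bell := (bellman P first_drawdown first_discount d).
Local Notation hor := (horizon_value P first_drawdown first_discount d).

Let hor_ge0 n x : (0 <= hor n x)%E.
Proof. exact: (horizon_value_ge0 P first_drawdown d first_discount01). Qed.

Let hor_measurable n : measurable_fun setT (hor n).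
Proof.
exact: (measurable_horizon_value P d first_drawdown_measurable
  first_drawdown_mono measurable_first_discount first_discount01 n).
Qed.

Let disc_ge0 u z b : (forall x, 0 <= u x)%E -> (0 <= disc u z b)%E.
Proof. exact: (discounted_ge0 P first_drawdown first_discount01). Qed.

Let g := fine (mean_discount P first_discount).

Let gE : mean_discount P first_discount = g%:E.
Proof.
rewrite /g fineK// ge0_fin_numE; last first.
  exact: (mean_discount_ge0 P first_discount01).
apply: lt_trans (ltry 1).
exact: (mean_discount_lt1 P measurable_first_discount first_discount01).
Qed.

Let g_ge0 : 0 <= g.
Proof. by rewrite -lee_fin -gE; exact: (mean_discount_ge0 P first_discount01). Qed.

Let g_lt1 : g < 1.
Proof.
rewrite -lte_fin -gE.
exact: (mean_discount_lt1 P measurable_first_discount first_discount01).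
Qed.

Let weight k w : \bar R := (expR (- r * T k w))%:E.

Let weight_ge0 k w : (0 <= weight k w)%E.
Proof. by rewrite lee_fin expR_ge0. Qed.

Let measurable_weight k : measurable_fun setT (weight k).
Proof.
apply/measurable_EFinP; apply: measurableT_comp => //; apply: measurable_funM => //.
exact: measurable_arrival_time N_renewal k.
Qed.

(** The weight at [T k.+1] is the weight at [T k] times the discount over the gap. The strong Markov
    property then replaces the block after [T k] by an independent copy of the first one, with
    drawdown and action frozen. *)
Lemma integral_discounted_restart k (z b : Om -> R) (u : R -> \bar R) :
  measurable_fun setT (z : g_sigma_algebraType (S k) -> R) ->
  measurable_fun setT (b : g_sigma_algebraType (S k) -> R) ->
  measurable_fun setT u -> (forall x, 0 <= u x)%E ->
  (\int[P]_w (weight k w * disc u (z w) (b w)) =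
   \int[P]_w (weight k.+1 w * u (drawdown_map eta theta sigma (z w) (b w)
      (T k.+1 w - T k w) (shifted_path W (T k) w))))%E.
Proof.
move=> mz mb mu u0.
pose f (x : g_sigma_algebraType (S k) * (R * path_space R (nat * nat)%type)) :=
  (weight k x.1 * ((expR (- r * x.2.1))%:E *
    u (drawdown_map eta theta sigma (z x.1) (b x.1) x.2.1 x.2.2)))%E.
have mTk : measurable_fun setT (T k : g_sigma_algebraType (S k) -> R).
  exact: (measurable_arrival (k := k) T0 T_increasing T_count).
have m21 : measurable_fun setT
    (fun x : g_sigma_algebraType (S k) * (R * path_space R (nat * nat)%type) => x.2.1).
  exact: (measurableT_comp measurable_fst measurable_snd).
have mf : measurable_fun setT f.
  apply: emeasurable_funM.
    apply/measurable_EFinP; apply: measurableT_comp => //; apply: measurable_funM => //.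
    exact: (measurableT_comp mTk measurable_fst).
  apply: emeasurable_funM.
    by apply/measurable_EFinP; apply: measurableT_comp => //; exact: measurable_funM.
  apply: (measurableT_comp mu); apply: measurable_drawdown_map => //.
  - exact: (measurableT_comp mz measurable_fst).
  - exact: (measurableT_comp mb measurable_fst).
  - exact: (measurableT_comp measurable_snd measurable_snd).
have f0 x : (0 <= f x)%E.
  by rewrite /f mule_ge0// mule_ge0 ?lee_fin ?expR_ge0.
have h := integral_strong_markov W_brownian N_renewal W_N_independent mf f0.
transitivity (\int[P]_w \int[P]_w' f (w, renewal_block W T 0 w'))%E.
  apply: eq_integral => w _; rewrite /f/= ge0_integralZl//.
  - apply: emeasurable_funM; first exact/measurable_EFinP/measurable_first_discount.
    apply: (measurableT_comp mu); apply: measurable_drawdown_map => //.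
    + exact: (measurableT_comp measurable_fst
        (measurable_renewal_block W_brownian N_renewal 0)).
    + exact: (measurableT_comp measurable_snd
        (measurable_renewal_block W_brownian N_renewal 0)).
  - by move=> w' _; rewrite mule_ge0 ?lee_fin ?expR_ge0.
rewrite -h; apply: eq_integral => w _; rewrite /f /weight /= muleA -EFinM -expRD.
by congr ((expR _)%:E * _)%E; ring.
Qed.

(** * Costs of a fixed strategy, arrival by arrival *)

Section strategy.
Variables (B : R -> Om -> R) (b : nat -> Om -> R) (z : R).
Hypothesis b01 : forall k w, 0 <= b k w <= 1.
Hypothesis BE : forall t w, 0 <= t -> B t w = b (N t w) w.
Hypothesis b_adapted : forall k,
  measurable_fun setT (b k : g_sigma_algebraType (S k) -> R).
Hypothesis z_ge0 : 0 <= z.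

Let Z k w := drawdown eta theta sigma W N T B z (T k w) w.

Let Z_adapted k : measurable_fun setT (Z k : g_sigma_algebraType (S k) -> R).
Proof.
exact: (measurable_drawdown_arrival eta theta sigma W_continuous T0 T_increasing
  T_count b01 BE z_ge0 b_adapted (k := k)).
Qed.

Let Z_measurable k : measurable_fun setT (Z k).
Proof. exact: (measurable_fun_of_sub (S_sigma k) (@S_measurable k) (@Z_adapted k)). Qed.

Let b_measurable k : measurable_fun setT (b k).
Proof. exact: (measurable_fun_of_sub (S_sigma k) (@S_measurable k) (@b_adapted k)). Qed.

Definition expected_charge k : \bar R :=
  (\int[P]_w (weight k w * (d < Z k w)%R%:R%:E))%E.

Let measurable_charge k : measurable_fun setT (fun w => (d < Z k w)%R%:R%:E : \bar R).
Proof.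
have h : {homo (fun x : R => (d < x)%R%:R%:E : \bar R) : x y / x <= y >-> (x <= y)%E}.
  move=> x y xy; rewrite lee_fin ler_nat; case: (ltP d x) => // dx.
  by rewrite (lt_le_trans dx xy).
exact: (measurableT_comp (nondecreasing_emeasurable h) (@Z_measurable k)).
Qed.

Lemma strategy_value_charges :
  strategy_value eta theta sigma W N T d r P B z =
  (\sum_(0 <= k <oo) expected_charge k)%E.
Proof.
transitivity (\int[P]_w \sum_(0 <= k <oo) (weight k w * (d < Z k w)%R%:R%:E))%E.
  by apply: eq_integral => w _; apply: eq_eseriesr => k _; rewrite /weight -EFinM.
rewrite integral_nneseries//.
- by move=> k; apply: emeasurable_funM; [exact: measurable_weight|exact: measurable_charge].
- by move=> k w _; rewrite mule_ge0 ?weight_ge0 ?lee_fin.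
Qed.

Lemma expected_charge_ge0 k : (0 <= expected_charge k)%E.
Proof. by apply: integral_ge0 => w _; rewrite mule_ge0 ?weight_ge0 ?lee_fin. Qed.

Let measurable_stage k u : measurable_fun setT u -> (forall x, 0 <= u x)%E ->
  measurable_fun setT (fun w => disc u (Z k w) (b k w)).
Proof.
move=> mu u0.
have m : measurable_fun setT (fun w => (Z k w, b k w)).
  by apply: measurable_fun_pair; [exact: Z_measurable|exact: b_measurable].
exact: (measurableT_comp (measurable_discounted P first_drawdown_measurable
  measurable_first_discount first_discount01 mu u0) m).
Qed.

(** One backward step: the charge at [T m] and the continuation from [T m.+1] become a single
    integral at [T m], whose integrand can be compared pointwise with the operator applied to
    [u]. *)
Lemma charge_then_restart m u : measurable_fun setT u -> (forall x, 0 <= u x)%E ->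
  (expected_charge m + \int[P]_w (weight m.+1 w * u (Z m.+1 w)) =
   \int[P]_w (weight m w * ((d < Z m w)%R%:R%:E + disc u (Z m w) (b m w))))%E.
Proof.
move=> mu u0.
under [RHS]eq_integral do rewrite ge0_muleDr ?lee_fin ?disc_ge0//.
rewrite ge0_integralD//; first last.
- by apply: emeasurable_funM; [exact: measurable_weight|exact: measurable_stage].
- by move=> w _; rewrite mule_ge0 ?weight_ge0 ?disc_ge0.
- by apply: emeasurable_funM; [exact: measurable_weight|exact: measurable_charge].
- by move=> w _; rewrite mule_ge0 ?weight_ge0 ?lee_fin.
congr (_ + _)%E; rewrite integral_discounted_restart//.
apply: eq_integral => w _; rewrite /Z.
by rewrite (drawdown_shifted_step eta theta sigma W_continuous T0 T_increasing
  T_count b01 BE z m w).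
Qed.

(** The starting index [m] is arbitrary because removing the first charge moves the start to [m.+1].
    The actual action is one competitor in the infimum. *)
Lemma horizon_le_charges n m :
  (\int[P]_w (weight m w * hor n (Z m w)) <= \sum_(k < n) expected_charge (m + k))%E.
Proof.
elim: n m => [|n IH] m.
  rewrite big_ord0; under eq_integral do rewrite mule0.
  by rewrite integral0.
rewrite big_ord_recl/= addn0.
apply: (@le_trans _ _ (expected_charge m +
    \int[P]_w (weight m.+1 w * hor n (Z m.+1 w)))%E); last first.
  apply: leeD => //; apply: (le_trans (IH m.+1)).
  apply: lee_sum => k _.
  suff -> : (m.+1 + k = m + bump 0 k)%N by [].
  by rewrite /bump leq0n add1n addSnnS.
rewrite charge_then_restart//; apply: ge0_le_integral => //.
- by move=> w _; rewrite mule_ge0 ?weight_ge0//; exact: (hor_ge0 n.+1).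
- apply: emeasurable_funM; first exact: measurable_weight.
  exact: (measurableT_comp (@hor_measurable n.+1) (@Z_measurable m)).
- apply: emeasurable_funM; first exact: measurable_weight.
  by apply: emeasurable_funD; [exact: measurable_charge|exact: measurable_stage].
- move=> w _; rewrite lee_wpmul2l ?weight_ge0//= leeD2l//.
  by apply: ereal_inf_lbound; exists (b m w) => //; rewrite /= in_itv/= b01.
Qed.

Lemma horizon_le_strategy_value n :
  (hor n z <= strategy_value eta theta sigma W N T d r P B z)%E.
Proof.
rewrite strategy_value_charges.
apply: (@le_trans _ _ (\sum_(k < n) expected_charge k)%E); last first.
  rewrite -(big_mkord xpredT expected_charge).
  by apply: nneseries_lim_ge => k _ _; exact: expected_charge_ge0.
apply: le_trans (horizon_le_charges n 0).
under eq_integral.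
  move=> w _; rewrite /weight /Z T0 mulr0 expR0 mul1e.
  rewrite (drawdown_start eta theta sigma W T0 T_increasing T_count B w z_ge0).
  over.
by rewrite integral_cst_prob.
Qed.

(** Restarting with the constant function 1 yields one factor g per arrival; drawdown and action are
    irrelevant there and are set to 0. *)
Lemma mean_weight k : (\int[P]_w weight k w = (g ^+ k)%:E)%E.
Proof.
elim: k => [|k IH].
  rewrite expr0; under eq_integral do rewrite /weight T0 mulr0 expR0.
  by rewrite integral_cst_prob.
have mc : measurable_fun setT (cst 0 : g_sigma_algebraType (S k) -> R).
  exact: measurable_cst.
have m1 : measurable_fun setT (cst 1%E : R -> \bar R) by exact: measurable_cst.
have h := integral_discounted_restart mc mc m1 (fun=> lee01).
have dE z' b' : disc (cst 1%E) z' b' = g%:E.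
  by rewrite -gE; apply: eq_integral => w _; rewrite mule1.
transitivity (\int[P]_w (weight k.+1 w * 1))%E.
  by apply: eq_integral => w _; rewrite mule1.
transitivity (\int[P]_w (weight k w * disc (cst 1%E) 0%R 0%R))%E.
  exact: (esym h).
under eq_integral do rewrite dE.
by rewrite ge0_integralZr// ?lee_fin// IH -EFinM exprSr.
Qed.

Lemma expected_charge_le k : (expected_charge k <= (g ^+ k)%:E)%E.
Proof.
rewrite -mean_weight; apply: ge0_le_integral => //.
- by move=> w _; rewrite mule_ge0 ?weight_ge0 ?lee_fin.
- by apply: emeasurable_funM; [exact: measurable_weight|exact: measurable_charge].
- by move=> w _; rewrite -[leRHS]mule1 lee_wpmul2l// lee_fin lern1; case: (_ < _).
Qed.

(** Here j counts the stages still to go, so the induction runs backwards from arrival n. Each stage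
    loses at most [e], because the mean weight is at most 1. *)
Lemma charges_le_horizon n e : 0 <= e ->
  (forall j w, (j < n)%N -> (d < Z (n - j.+1) w)%R%:R%:E +
     disc (hor j) (Z (n - j.+1) w) (b (n - j.+1) w) <=
     hor j.+1 (Z (n - j.+1) w) + e%:E)%E ->
  forall j, (j <= n)%N ->
  (\sum_(k < j) expected_charge (n - j + k) <=
   \int[P]_w (weight (n - j) w * hor j (Z (n - j) w)) + (j%:R * e)%:E)%E.
Proof.
move=> e0 opt; elim=> [|j IH] jn.
  rewrite big_ord0 mul0r adde0 integral_ge0// => w _.
  by rewrite mule_ge0 ?weight_ge0.
set m := (n - j.+1)%N.
have mS : (n - j = m.+1)%N by rewrite /m subnSK.
rewrite big_ord_recl/= addn0.
have {}IH := IH (ltnW jn); rewrite mS in IH.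
apply: (@le_trans _ _ (expected_charge m +
    (\int[P]_w (weight m.+1 w * hor j (Z m.+1 w)) + (j%:R * e)%:E))%E).
  apply: leeD => //; apply: le_trans IH.
  apply: lee_sum => k _.
  suff -> : (m.+1 + k = m + bump 0 k)%N by [].
  by rewrite /bump leq0n add1n addSnnS.
rewrite addeA charge_then_restart// -natr1 mulrDl mul1r EFinD.
rewrite [X in (_ <= _ + X)%E]addeC addeA.
apply: leeD => //.
apply: (@le_trans _ _
  (\int[P]_w (weight m w * hor j.+1 (Z m w) + weight m w * e%:E))%E).
  apply: ge0_le_integral => //.
  - move=> w _; rewrite mule_ge0 ?weight_ge0// adde_ge0 ?lee_fin//.
    exact: disc_ge0.
  - apply: emeasurable_funM; first exact: measurable_weight.
    by apply: emeasurable_funD; [exact: measurable_charge|exact: measurable_stage].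
  - apply: emeasurable_funD; apply: emeasurable_funM => //.
    exact: (measurableT_comp (@hor_measurable j.+1) (@Z_measurable m)).
  - move=> w _; rewrite -ge0_muleDr ?lee_fin ?(hor_ge0 j.+1)//.
    by rewrite lee_wpmul2l ?weight_ge0//; exact: opt.
rewrite ge0_integralD//; first last.
- by apply: emeasurable_funM => //; exact: measurable_cst.
- by move=> w _; rewrite mule_ge0 ?weight_ge0 ?lee_fin.
- apply: emeasurable_funM => //.
  exact: (measurableT_comp (@hor_measurable j.+1) (@Z_measurable m)).
- by move=> w _; rewrite mule_ge0 ?weight_ge0//; exact: (hor_ge0 j.+1).
apply: leeD => //; rewrite ge0_integralZr// mean_weight -EFinM lee_fin.
by rewrite ler_piMl// exprn_ile1// ltW.
Qed.

(** The first n charges are bounded by the finite horizon estimate. Whatever is played afterwards,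
    the charge at arrival k is at most g^k, and the geometric series from n on gives the last
    term. *)
Lemma strategy_value_le_horizon n e : 0 <= e ->
  (forall j w, (j < n)%N -> (d < Z (n - j.+1) w)%R%:R%:E +
     disc (hor j) (Z (n - j.+1) w) (b (n - j.+1) w) <=
     hor j.+1 (Z (n - j.+1) w) + e%:E)%E ->
  (strategy_value eta theta sigma W N T d r P B z <=
   hor n z + (n%:R * e)%:E + (g ^+ n / (1 - g))%:E)%E.
Proof.
move=> e0 opt; rewrite strategy_value_charges.
apply: (@le_nneseries_partial _ _ _ n); first exact: expected_charge_ge0.
move=> m; rewrite big_split_ord/=; apply: leeD.
  have := charges_le_horizon e0 opt (leqnn n); rewrite subnn.
  move=> /le_trans; apply; apply: leeD => //.
  under eq_integral.
    move=> w _; rewrite /weight /Z T0 mulr0 expR0 mul1e.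
    rewrite (drawdown_start eta theta sigma W T0 T_increasing T_count B w z_ge0).
    over.
  by rewrite integral_cst_prob.
apply: (@le_trans _ _ (\sum_(k < m) (g ^+ (n + k))%:E)%E).
  by apply: lee_sum => k _; exact: expected_charge_le.
rewrite sumEFin lee_fin.
have -> : \sum_(k < m) g ^+ (n + k) = g ^+ n * (1 - g ^+ m) / (1 - g).
  apply: (canRL (mulfK _)); first by rewrite subr_eq0 gt_eqF.
  elim: m => [|m IH]; first by rewrite big_ord0 mul0r expr0 subrr mulr0.
  by rewrite big_ord_recr/= mulrDl IH exprD exprS; ring.
rewrite ler_pM2r ?invr_gt0 ?subr_gt0// ler_piMr ?exprn_ge0//.
by rewrite gerBl exprn_ge0.
Qed.

End strategy.

Lemma near_optimal_strategy n e z : 0 < e -> 0 <= z ->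
  exists2 B, strategies W N T B &
    (strategy_value eta theta sigma W N T d r P B z <=
     hor n z + (n%:R * e)%:E + (g ^+ n / (1 - g))%:E)%E.
Proof.
move=> e0 z0.
have /choice[beta betaP] : forall j, exists beta : R -> R,
    [/\ measurable_fun setT beta, forall x, 0 <= beta x <= 1 &
    forall x, ((d < x)%R%:R%:E + disc (hor j) x (beta x) <= bell (hor j) x + e%:E)%E].
  move=> j; apply: measurable_selector => //.
  - exact: first_drawdown_measurable.
  - exact: first_drawdown_mono.
  - exact: measurable_first_discount.
  - exact: first_discount01.
  - exact: (horizon_value_mono P d first_drawdown_measurable first_drawdown_mono
      measurable_first_discount first_discount01).
  - exact: (horizon_value_fin P d first_drawdown_measurable first_drawdown_mono
      measurable_first_discount first_discount01 j.+1).
(* With n - k stages to go at arrival k, the action is nearly optimal against the value of the n - k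
   - 1 stages that follow; after the horizon the action 0 is an arbitrary choice. *)
pose bb k := if (k < n)%N then beta (n - k.+1)%N else cst 0.
(* The actions depend on the drawdown, which depends on the earlier actions. The recursion builds
   both before any strategy exists, with the stopped path for adaptedness; [ZE] identifies [Z] with
   the true drawdown afterwards. *)
pose Z := fix Z k : Om -> R := match k with
  | 0%N => fun=> z
  | j.+1 => fun w => drawdown_map eta theta sigma (Z j w) (bb j (Z j w))
      (T j.+1 w - T j w) (stopped_path W T j w)
  end.
have mbb k : measurable_fun setT (bb k).
  by rewrite /bb; case: ifP => // _; have [] := betaP (n - k.+1)%N.
have bb01 k x : 0 <= bb k x <= 1.
  by rewrite /bb; case: ifP => _ /=; [have [] := betaP (n - k.+1)%N|rewrite lexx ler01].
have mZ k : measurable_fun setT (Z k : g_sigma_algebraType (S k) -> R).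
  elim: k => [|k IH]; first exact: measurable_cst.
  apply: (measurable_drawdown_next eta theta sigma W_continuous T0 T_increasing
    T_count IH).
  exact: (measurableT_comp (mbb k) IH).
pose b k w := bb k (Z k w).
have mb k : measurable_fun setT (b k : g_sigma_algebraType (S k) -> R).
  exact: (measurableT_comp (mbb k) (mZ k)).
have b01 k w : 0 <= b k w <= 1 by exact: bb01.
pose B t w := b (N t w) w.
have BE t w : 0 <= t -> B t w = b (N t w) w by [].
have ZE k w : drawdown eta theta sigma W N T B z (T k w) w = Z k w.
  elim: k => [|k IH].
    by rewrite T0 (drawdown_start eta theta sigma W T0 T_increasing T_count B w z0).
  rewrite (drawdown_stopped_step eta theta sigma W_continuous T0 T_increasing
    T_count b01 BE z k w).
  by rewrite IH.
exists B.
  exists b; split => // k; apply/sub_measurableP; first exact: S_sigma.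
  exact: mb.
apply: (strategy_value_le_horizon b01 BE mb z0 (ltW e0)) => j w jn.
rewrite ZE /b /bb; case: ifPn => [_|]; last first.
  by rewrite -leqNgt leqNgt ltn_subrL /= (leq_ltn_trans _ jn).
rewrite subnSK// (subKn (ltnW jn)).
by have [_ _] := betaP j; apply.
Qed.

(** * Passage to the infinite horizon *)

Let v := value eta theta sigma W N T d r P.

Lemma horizon_le_value n z : 0 <= z -> (hor n z <= v z)%E.
Proof.
move=> z0; apply: le_ereal_inf_tmp => _ [B [b [sb b01 BE]] <-].
apply: (horizon_le_strategy_value b01 (fun t w => BE t w) _ z0) => k.
by apply/(sub_measurableP _ (S_sigma k)); exact: sb.
Qed.

Lemma value_le_horizon n z : 0 <= z ->
  (v z <= hor n z + (g ^+ n / (1 - g))%:E)%E.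
Proof.
move=> z0; apply/lee_addgt0Pr => e e0.
(* The division by n + 1 keeps the total loss of n stages below [e] and makes sense for n = 0. *)
have e10 : 0 < e / n.+1%:R by rewrite divr_gt0.
have [B BS Be] := near_optimal_strategy n e10 z0.
apply: (@le_trans _ _ (strategy_value eta theta sigma W N T d r P B z)).
  by apply: ereal_inf_lbound; exists B.
apply: (le_trans Be); rewrite addeAC; apply: leeD => //.
by rewrite lee_fin mulrCA ler_piMr ?ltW// ltr_pdivrMr// mul1r ltr_nat.
Qed.

Let tail_cvg : g ^+ n / (1 - g) @[n --> \oo] --> (0 : R).
Proof.
have g1 : `|g| < 1 by rewrite ger0_norm.
have := cvg_geometric ((1 - g)^-1) g1; apply: cvg_trans; apply: near_eq_cvg.
by near=> n; rewrite /geometric/= mulrC.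
Unshelve. all: by end_near. Qed.

Let le_tail (x y : \bar R) :
  (forall n, x <= y + (g ^+ n / (1 - g))%:E)%E -> (x <= y)%E.
Proof.
move=> xy; apply/lee_addgt0Pr => e e0.
have [n _ /(_ n (leqnn _)) ne] : \forall n \near \oo, g ^+ n / (1 - g) < e.
  by apply: (cvgr_lt _ tail_cvg).
by apply: (le_trans (xy n)); rewrite leeD2l// lee_fin ltW.
Qed.

Lemma value_ge0 z : (0 <= v z)%E.
Proof.
apply: le_ereal_inf_tmp => _ [B _ <-]; apply: integral_ge0 => w _.
by apply: nneseries_ge0 => k _ _; rewrite lee_fin mulr_ge0// expR_ge0.
Qed.

(** Inherited from the finite horizon values, which approximate [v] uniformly on the half-line. It
    supplies the measurability of the continuation value. *)
Lemma value_mono x y : 0 <= x -> x <= y -> (v x <= v y)%E.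
Proof.
move=> x0 xy; apply: le_tail => n; apply: (le_trans (value_le_horizon n x0)).
apply: leeD => //; apply: le_trans (horizon_le_value n (le_trans x0 xy)).
exact: (horizon_value_mono P d first_drawdown_measurable first_drawdown_mono
  measurable_first_discount first_discount01 n xy).
Qed.

Lemma first_drawdownE z b w : 0 <= z -> 0 <= b <= 1 ->
  drawdown eta theta sigma W N T (fun _ _ => b) z (T 1%N w) w =
  first_drawdown z b w.
Proof.
move=> z0 b01.
have := @drawdown_shifted_step _ _ _ eta theta sigma W N T W_continuous T0
  T_increasing T_count (fun _ _ => b) (fun _ _ => b) (fun _ _ => b01)
  (fun _ _ _ => erefl) z 0%N w.
have -> : drawdown eta theta sigma W N T (fun _ _ => b) z (T 0%N w) w = z.
  by rewrite T0 (drawdown_start eta theta sigma W T0 T_increasing T_count _ w z0).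
by [].
Qed.

Lemma value_bellman z : 0 <= z ->
  v z = bell (fun x => v (Num.max 0 x)) z.
Proof.
(* The estimates on [v] hold for nonnegative drawdowns, while the operator acts on functions on all
   of R. Composing with [Num.max 0] bridges this, and by [D0] it changes nothing at the drawdowns
   that occur. *)
move=> z0; pose u x := v (Num.max 0 x).
have u0 x : (0 <= u x)%E by exact: value_ge0.
have m0 x : 0 <= Num.max 0 x :> R by rewrite le_max lexx.
have mu : measurable_fun setT u.
  apply: nondecreasing_emeasurable => x y xy; apply: value_mono => //.
  by rewrite ge_max !le_max lexx xy orbT.
have D0 b w : 0 <= b <= 1 -> 0 <= first_drawdown z b w.
  move=> b01; rewrite -first_drawdownE//.
  exact: (@drawdown_arrival_ge0 _ _ _ eta theta sigma W N T W_continuous T0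
    T_increasing T_count (fun _ _ => b) (fun _ _ => b) w (fun=> b01)
    (fun _ _ => erefl) z 1%N z0).
have disc_le b : 0 <= b <= 1 -> forall n,
    (disc (hor n) z b <= disc u z b)%E /\
    (disc u z b <= disc (hor n) z b + (g ^+ n / (1 - g))%:E)%E.
  move=> b01 n; have D0w w := D0 b w b01.
  have t0 : (0 <= (g ^+ n / (1 - g))%:E)%E.
    by rewrite lee_fin divr_ge0 ?exprn_ge0 ?subr_ge0 ?(ltW g_lt1).
  split.
    apply: (le_discounted _ first_drawdown_measurable measurable_first_discount
      first_discount01 (hor_measurable n) mu (hor_ge0 n)) => w.
    by rewrite /u max_r//; exact: horizon_le_value.
  apply: (@le_trans _ _ (disc (fun x => hor n x + (g ^+ n / (1 - g))%:E)%E z b)).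
    apply: (le_discounted _ first_drawdown_measurable measurable_first_discount
      first_discount01 mu _ u0) => [|w].
      by apply: emeasurable_funD => //; exact: measurable_cst.
    by rewrite /u max_r//; exact: value_le_horizon.
  rewrite (discountedD _ first_drawdown_measurable measurable_first_discount
    first_discount01 _ _ (hor_measurable n) (hor_ge0 n) t0).
  apply: leeD => //; rewrite gE -EFinM lee_fin ler_piMr//.
  exact: ltW.
apply/le_anti/andP; split.
  apply: le_tail => n.
  apply: (le_trans (value_le_horizon n z0)); apply: leeD => //.
  (* For horizon 0 the value is 0. For n + 1, the smaller value [hor n] is replaced by [u] under the
     operator. *)
  case: n => [|n]; first by apply: (bellman_ge0 P first_drawdown d first_discount01).
  rewrite /= leeD2l//; apply: le_ereal_inf_tmp => _ [b b01 <-].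
  apply: (@le_trans _ _ (disc (hor n) z b)); first by apply: ereal_inf_lbound; exists b.
  by have [] := disc_le b _ n; move: b01; rewrite /= in_itv.
apply: le_tail => n.
apply: (@le_trans _ _ (hor n.+1 z + (g ^+ n / (1 - g))%:E)%E); last first.
  by apply: leeD => //; exact: horizon_le_value.
rewrite /= -addeA leeD2l// -leeBlDr//; apply: le_ereal_inf_tmp => _ [b b01 <-].
rewrite leeBlDr//; apply: (@le_trans _ _ (disc u z b)).
  by apply: ereal_inf_lbound; exists b.
by have [] := disc_le b _ n; move: b01; rewrite /= in_itv.
Qed.

End verification.

Theorem theorem2p3 (R : realType) (disp : measure_display)
    (Om : measurableType disp) (P : probability Om R)
    (W : R -> Om -> R) (N : R -> Om -> nat) (T : nat -> Om -> R)
    (eta theta sigma d r : R)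
    (P_complete : measure_is_complete P)
    (W_brownian : standard_brownian_motion P W)
    (N_renewal : renewal_process P N T)
    (W_N_independent : independent_processes P W N)
    (eta_lt_theta : eta < theta) (sigma_gt0 : 0 < sigma)
    (d_gt0 : 0 < d) (r_gt0 : 0 < r) :
  let Delta (b : R) := drawdown eta theta sigma W N T (fun _ _ => b) in
  let v := value eta theta sigma W N T d r P in
  forall z : R, 0 <= z ->
    v z = ((z > d)%R%:R%:E +
           ereal_inf [set \int[P]_w ((expR (- r * T 1%N w))%:E *
                                     v (Delta b z (T 1%N w) w))
                     | b in `[0%R, 1%R]])%E.
Proof.
move=> Delta v z z0.
have T0 := renewal_start N_renewal.
apply: (etrans (value_bellman eta theta sigma d W_brownian N_renewal
  W_N_independent r_gt0 z0)).
apply: (congr1 (fun X => (z > d)%R%:R%:E + ereal_inf X)%E).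
apply: eq_imagel => b; rewrite /= in_itv/= => b01.
apply: eq_integral => w _; rewrite /first_discount /= T0 subr0.
(* The drawdown at [T 1] is nonnegative, so the truncation at 0 disappears. *)
rewrite -(first_drawdownE eta theta sigma W_brownian N_renewal w z0 b01) max_r//.
exact: (drawdown_arrival_ge0 eta theta sigma (bm_continuous W_brownian) T0
  (renewal_increasing N_renewal) (renewal_count N_renewal)
  (b := fun _ _ => b) (fun=> b01) (fun _ _ => erefl) 1%N z0).
Qed.
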